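(* Let $A$ be a dimer tree algebra with an admissible action of $G=\{1,\sigma\}$, let $AG$ be the skew group algebra, $F=-\otimes_AAG$, and let $M$ be an $A$-module. The module $M\oplus\sigma M$ is $\tau$-rigid in $\mathrm{mod}\,A$ if and only if the induced module $FM$ is $\tau$-rigid in $\mathrm{mod}\,AG$.
   Context: $\Bbbk$ is an algebraically closed field of characteristic different from 2; modules are finitely generated right modules. A chordless cycle in a quiver $Q$ is a cyclic path with pairwise distinct vertices such that the full subquiver on its vertices equals this cycle. Arrows in exactly one chordless cycle are boundary arrows; those in two or more are interior arrows. The dual graph of $Q$ has as vertices the chordless cycles and the boundary arrows; there is an edge labelled $\alpha$ between two chordless cycles sharing the arrow $\alpha$, and between a boundary arrow $\alpha$ and the chordless cycle containing it. A dimer tree quiver is a finite connected quiver without loops and 2-cycles such that every arrow lies in a chordless cycle, the dual graph is a tree, and the boundary arrows form a simple (non-oriented) cycle. Its potential is $W=\sum_C(-1)^{d(C)}C$ over all chordless cycles, $d(C)$ being the distance in the dual graph from $C$ to a fixed chordless cycle $C_0$ containing exactly one interior arrow (if $Q$ is a single chordless cycle, $C_0$ is that cycle). $A=\mathrm{Jac}(Q,W)$ is a dimer tree algebra. Admissible action: $\sigma$ acts as an algebra automorphism of $A$ mapping vertices to vertices and arrows to arrows, and fixes at least one vertex. $AG=A\otimes_\Bbbk\Bbbk G$ with $(a\otimes g)(a'\otimes g')=a\,g(a')\otimes gg'$. For an $A$-module $M$, $\sigma M$ is the same vector space with action $m\cdot_\sigma a=m\cdot\sigma(a)$. A module $M$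 over an algebra $\Lambda$ is $\tau$-rigid if $\mathrm{Hom}_\Lambda(M,\tau M)=0$, with $\tau$ the Auslander–Reiten translation in $\mathrm{mod}\,\Lambda$. *)

(* Defs.v *)
From HB Require Import structures.
From mathcomp Require Import all_boot all_order all_fingroup all_algebra.
From mathcomp Require Import finmap boolp classical_sets.
From mathcomp.multinomials Require Import monalg.

Set Implicit Arguments.
Unset Strict Implicit.
Unset Printing Implicit Defensive.

Import GRing.Theory.
Local Open Scope ring_scope.

(* The edge e joins x and y iff [mends e = [set x; y]]; parallel edges are
   distinct elements of [medges]. *)
Record mgraph (V E : finType) := MGraph {
  mverts : {set V};
  medges : {set E};
  mends : E -> {set V} }.

Section MGraph.
Variables (V E : finType) (G : mgraph V E).

Definition madj : rel V := fun x y =>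
  [&& x \in mverts G, y \in mverts G & [exists e in medges G, mends G e == [set x; y]]].

Definition mconnected : Prop :=
  mverts G != finset.set0 /\ {in mverts G &, forall x y, connect madj x y}.

(* [c] lists (vertex, edge leaving it towards the next vertex), cyclically. *)
Definition simple_mcycle (c : seq (V * E)) : bool :=
  [&& c != [::], uniq (map fst c), uniq (map snd c),
      all (fun p => (p.1 \in mverts G) && (p.2 \in medges G)) c &
      path.cycle (fun p q => mends G p.2 == [set p.1; q.1]) c].

Definition mtree : Prop := mconnected /\ forall c, ~~ simple_mcycle c.

Definition mdist (x y : V) : nat :=
  find (fun n => [exists p : n.-tuple V, path madj x p && (last x p == y)])
       (iota 0 #|V|).

End MGraph.

Record quiver := Quiver {
  vertex : finType;
  arrow : finType;
  src : arrow -> vertex;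
  tgt : arrow -> vertex }.

Section Quiver.
Variable Q : quiver.
Local Notation Q0 := (vertex Q).
Local Notation Q1 := (arrow Q).

Definition underlying_graph : mgraph Q0 Q1 :=
  MGraph [set: Q0]%SET [set: Q1]%SET (fun a => [set src a; tgt a]%SET).

Definition no_loops : Prop := forall a : Q1, src a != tgt a.
Definition no_2cycles : Prop :=
  forall a b : Q1, ~ (src a = tgt b /\ tgt a = src b).

Definition is_chordless_cycle (c : seq Q1) : bool :=
  [&& c != [::], path.cycle (fun a b => tgt a == src b) c, uniq (map (@src Q) c) &
      [forall a : Q1, (src a \in map (@src Q) c) && (tgt a \in map (@src Q) c)
                      ==> (a \in c)]].

(* A cyclic path with pairwise distinct vertices is determined, up to its
   starting point, by its set of arrows; chordless cycles are therefore handled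
   as sets of arrows. *)
Definition chordless_cycles : {set {set Q1}} :=
  [set C : {set Q1} |
     `[< exists2 c, is_chordless_cycle c & C = [set a in c]%SET >]]%SET.

Definition cycles_through (a : Q1) : {set {set Q1}} :=
  [set C in chordless_cycles | a \in C]%SET.

Definition boundary_arrows : {set Q1} := [set a | #|cycles_through a| == 1%N]%SET.
Definition interior_arrows : {set Q1} := [set a | (1 < #|cycles_through a|)%N]%SET.

(* Vertices: chordless cycles (inl) and boundary arrows (inr).  An edge is a
   pair (label, set of end points), so that two cycles sharing several arrows
   are joined by as many parallel edges. *)
Definition dual_graph : mgraph ({set Q1} + Q1)%type
                               (Q1 * {set ({set Q1} + Q1)%type})%type :=
  MGraph
    [set x | match x with
             | inl C => C \in chordless_cycles
             | inr a => a \in boundary_arrows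
             end]%SET
    [set e | [exists C in cycles_through e.1,
               [exists C' in cycles_through e.1,
                  (C != C') && (e.2 == [set inl C; inl C']%SET)]
               || ((e.1 \in boundary_arrows) &&
                   (e.2 == [set inl C; inr e.1]%SET))]]%SET
    snd.

Definition dimer_tree_quiver : Prop :=
  [/\ mconnected underlying_graph,
      no_loops /\ no_2cycles,
      forall a : Q1, exists2 C, C \in chordless_cycles & a \in C,
      mtree dual_graph &
      exists2 c, simple_mcycle underlying_graph c
               & [set a in map snd c]%SET = boundary_arrows].

Definition root_cycle (C0 : {set Q1}) : Prop :=
  C0 \in chordless_cycles /\
  (#|C0 :&: interior_arrows|%SET = 1%N \/ chordless_cycles = [set C0]%SET).

End Quiver.

Section QPath.
Variable Q : quiver.

(* Arrows are composed from left to right. *)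
Fixpoint is_qpath (i : vertex Q) (s : seq (arrow Q)) : bool :=
  if s is a :: s' then (src a == i) && is_qpath (tgt a) s' else true.

Record qpath := QPath {
  qpath_val :> vertex Q * seq (arrow Q);
  _ : is_qpath qpath_val.1 qpath_val.2 }.

HB.instance Definition _ := [isSub for qpath_val].
HB.instance Definition _ := [Choice of qpath by <:].

Definition qstart (p : qpath) : vertex Q := (val p).1.
Definition qarrows (p : qpath) : seq (arrow Q) := (val p).2.
Definition qend (p : qpath) : vertex Q := last (qstart p) (map (@tgt Q) (qarrows p)).

Lemma is_qpath_cat i s1 s2 :
  is_qpath i (s1 ++ s2) = is_qpath i s1 && is_qpath (last i (map (@tgt Q) s1)) s2.
Proof. by elim: s1 i => //= a s1 IH i; rewrite IH andbA. Qed.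

End QPath.

Section LinearExtension.
Variables (k : comNzRingType) (K : choiceType) (V : lmodType k).

Definition malg_lift (h : K -> V) (f : {malg k[K]}) : V :=
  \sum_(p <- msupp f) f@_p *: h p.

Lemma malg_liftw h (d : {fset K}) f :
  (msupp f `<=` d)%fset -> malg_lift h f = \sum_(p <- d) f@_p *: h p.
Proof.
move=> le_d; rewrite /malg_lift (big_fset_incl _ le_d) // => p _ pN.
by rewrite mcoeff_outdom ?scale0r.
Qed.

Lemma malg_lift_is_linear h : linear (malg_lift h).
Proof.
move=> c f g; pose d := (msupp f `|` msupp g `|` msupp (c *: f + g))%fset.
rewrite !(@malg_liftw h d) /d;
  try by apply/fsubsetP => x xs; rewrite !inE xs ?orbT.
rewrite scaler_sumr -big_split /=; apply: eq_bigr => p _.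
by rewrite mcoeffD mcoeffZ scalerDl scalerA.
Qed.

HB.instance Definition _ h :=
  GRing.isLinear.Build k {malg k[K]} V _ (malg_lift h) (malg_lift_is_linear h).

Lemma malg_liftU h p : malg_lift h << p >> = h p.
Proof. by rewrite /malg_lift msuppU oner_eq0 big_seq_fset1 mcoeffUU scale1r. Qed.

Lemma malgZU (c : k) (p : K) : << c *g p >> = c *: << p >> :> {malg k[K]}.
Proof. by apply/malgP => q; rewrite mcoeffZ !mcoeffU mulr_natr. Qed.

End LinearExtension.

Definition path_algebra (k : comNzRingType) (Q : quiver) : Type := {malg k[qpath Q]}.
HB.instance Definition _ (k : comNzRingType) (Q : quiver) :=
  GRing.Lmodule.on (path_algebra k Q).

(* The basis and the product are locked to keep unification from computing with
   finitely supported functions. *)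
HB.lock Definition qbasis (k : comNzRingType) (Q : quiver) (p : qpath Q) :
  path_algebra k Q := << p >>.

(* The basis element given by the word s read from the vertex i, or 0 if this
   word is not a path starting at i. *)
Definition qword (k : comNzRingType) (Q : quiver) (i : vertex Q) (s : seq (arrow Q)) :
  path_algebra k Q := if insub (i, s) is Some p then qbasis k p else 0.

HB.lock Definition qmul (k : comNzRingType) (Q : quiver) (f g : path_algebra k Q) :
  path_algebra k Q :=
  malg_lift (fun p => malg_lift (fun q =>
    if qend p == qstart q then qword k (qstart p) (qarrows p ++ qarrows q)
    else 0) g) f.

Section PathAlgebra.
Variables (k : comNzRingType) (Q : quiver).
Local Notation kQ := (path_algebra k Q).
Local Notation qmul := (qmul (k := k) (Q := Q)).
Local Notation qword := (qword k (Q := Q)).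
Local Notation qbasis := (qbasis k (Q := Q)).

Definition qidem (i : vertex Q) : kQ := qword i [::].
Definition qarrow (a : arrow Q) : kQ := qword (src a) [:: a].
Definition qone : kQ := \sum_i qidem i.

Lemma qpathP (p : qpath Q) : is_qpath (qstart p) (qarrows p).
Proof. by case: p. Qed.

Lemma qword_path p : qword (qstart p) (qarrows p) = qbasis p.
Proof.
rewrite /qword insubT /=; first exact: qpathP.
by move=> H; congr (qbasis _); apply: val_inj; case: p H => [[i s]].
Qed.

Lemma qwordT i s (H : is_qpath i s) :
  exists2 p : qpath Q, qword i s = qbasis p & val p = (i, s).
Proof. by exists (@QPath Q (i, s) H) => //; rewrite -qword_path. Qed.

Lemma qword0 i s : ~~ is_qpath i s -> qword i s = 0.
Proof. by move=> H; rewrite /qword insubN. Qed.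

Lemma qmul_linl g c f f' : qmul (c *: f + f') g = c *: qmul f g + qmul f' g.
Proof. by rewrite qmul.unlock linearP. Qed.

Lemma qmul_linr f c g g' : qmul f (c *: g + g') = c *: qmul f g + qmul f g'.
Proof.
rewrite qmul.unlock /malg_lift scaler_sumr -big_split /=.
by apply: eq_bigr => p _; rewrite -!/(malg_lift _ _) linearP scalerDr !scalerA mulrC.
Qed.

Lemma qmul0l g : qmul 0 g = 0.
Proof. by have := qmul_linl g (-1) 0 0; rewrite scaler0 add0r scaleN1r addNr. Qed.
Lemma qmul0r f : qmul f 0 = 0.
Proof. by have := qmul_linr f (-1) 0 0; rewrite scaler0 add0r scaleN1r addNr. Qed.

Fact qmulDl : left_distributive qmul +%R.
Proof. by move=> f g h; have := qmul_linl h 1 f g; rewrite !scale1r. Qed.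
Fact qmulDr : right_distributive qmul +%R.
Proof. by move=> f g h; have := qmul_linr f 1 g h; rewrite !scale1r. Qed.

Lemma qmulW i s j s' : is_qpath i s -> is_qpath j s' ->
  qmul (qword i s) (qword j s') =
  if last i (map (@tgt Q) s) == j then qword i (s ++ s') else 0.
Proof.
move=> /qwordT [p -> ep] /qwordT [q -> eq].
rewrite qmul.unlock qbasis.unlock !malg_liftU.
by rewrite /qend /qstart /qarrows ep eq.
Qed.

Lemma path_algebra_ind (P : kQ -> Prop) :
  P 0 -> (forall c f g, P f -> P g -> P (c *: f + g)) -> (forall p, P (qbasis p)) ->
  forall f, P f.
Proof.
move=> P0 PD PU f; rewrite (monalgE f).
suff H (s : seq (qpath Q)) : P (\sum_(p <- s) << f@_p *g p >>) by exact: H.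
elim: s => [|p s IH]; first by rewrite big_nil.
rewrite big_cons; have -> : << f@_p *g p >> = f@_p *: qbasis p.
  by rewrite qbasis.unlock; apply: malgZU.
exact: PD.
Qed.

Fact qmulA : associative qmul.
Proof.
move=> f g h; elim/path_algebra_ind: f => [|c f f' IH IH'|p].
- by rewrite !qmul0l.
- by rewrite !qmul_linl IH IH'.
elim/path_algebra_ind: g => [|c g g' IH IH'|q].
- by rewrite qmul0l !qmul0r qmul0l.
- by rewrite qmul_linl !qmul_linr qmul_linl IH IH'.
elim/path_algebra_ind: h => [|c h h' IH IH'|r].
- by rewrite !qmul0r.
- by rewrite !qmul_linr IH IH'.
rewrite -!qword_path.
rewrite (qmulW (qpathP q) (qpathP r)) (qmulW (qpathP p) (qpathP q)).
case: eqP => [eqr|nqr]; case: eqP => [epq|npq].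
- rewrite !qmulW ?is_qpath_cat ?qpathP ?epq ?eqr ?qpathP // eqxx.
  by rewrite map_cat last_cat epq eqr eqxx catA.
- rewrite qmul0l qmulW ?is_qpath_cat ?qpathP ?eqr ?qpathP //.
  by case: eqP npq.
- rewrite qmul0r qmulW ?is_qpath_cat ?qpathP ?epq ?qpathP //.
  by rewrite map_cat last_cat epq; case: eqP nqr.
- by rewrite qmul0l qmul0r.
Qed.

Fact qmul1l : left_id qone qmul.
Proof.
move=> f; elim/path_algebra_ind: f => [|c f f' IH IH'|p].
- exact: qmul0r.
- by rewrite qmul_linr IH IH'.
have -> : qmul qone (qbasis p) = \sum_i qmul (qidem i) (qbasis p).
  rewrite /qone; elim/big_rec2: _ => [|i x y _ <-]; first exact: qmul0l.
  exact: qmulDl.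
rewrite -qword_path (bigD1 (qstart p)) //= big1 ?addr0 => [|i ni].
  by rewrite qmulW ?qpathP //= eqxx.
by rewrite qmulW ?qpathP //= (negbTE ni).
Qed.

Fact qmul1r : right_id qone qmul.
Proof.
move=> f; elim/path_algebra_ind: f => [|c f f' IH IH'|p].
- exact: qmul0l.
- by rewrite qmul_linl IH IH'.
have -> : qmul (qbasis p) qone = \sum_i qmul (qbasis p) (qidem i).
  rewrite /qone; elim/big_rec2: _ => [|i x y _ <-]; first exact: qmul0r.
  exact: qmulDr.
rewrite -qword_path (bigD1 (qend p)) //= big1 ?addr0 => [|i ni].
  by rewrite qmulW ?qpathP //= eqxx cats0.
by rewrite qmulW ?qpathP //= eq_sym (negbTE ni).
Qed.

(* For a quiver without vertices this ring is zero, which MathComp's [algType]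
   excludes; hence only the ring and the k-module structures are declared. *)
HB.instance Definition _ :=
  GRing.Zmodule_isPzRing.Build kQ qmulA qmul1l qmul1r qmulDl qmulDr.

(* The cyclic derivative of a cyclic path is the sum, over the occurrences of
   the arrow a in it, of the path that starts right after that occurrence and
   runs once around up to it. *)
Definition cyclic_derivative (a : arrow Q) : kQ -> kQ :=
  malg_lift (fun p : qpath Q =>
    if qend p == qstart p then
      \sum_(j < size (qarrows p) | nth a (qarrows p) j == a)
         qword (tgt a) (drop j.+1 (qarrows p) ++ take j (qarrows p))
    else 0).

End PathAlgebra.

Section Jacobian.
Variables (k : comNzRingType) (Q : quiver).

(* The starting point is chosen arbitrarily; cyclic derivatives do not depend
   on it. *)
Definition cycle_path (C : {set arrow Q}) : path_algebra k Q :=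
  let c := xget [::] [set c | is_chordless_cycle c /\ C = [set a in c]%SET]%classic in
  if c is a :: _ then qword k (src a) c else 0.

Definition potential (C0 : {set arrow Q}) : path_algebra k Q :=
  \sum_(C in chordless_cycles Q)
     (-1) ^+ mdist (dual_graph Q) (inl C) (inl C0) *: cycle_path C.

Definition jacobian_ideal (W x : path_algebra k Q) : Prop :=
  exists s : seq (path_algebra k Q * arrow Q * path_algebra k Q),
    x = \sum_(u <- s) u.1.1 * cyclic_derivative u.1.2 W * u.2.

(* pi identifies A with the quotient of the path algebra by the ideal generated
   by the cyclic derivatives of W. *)
Definition is_jacobian_algebra (W : path_algebra k Q) (A : algType k)
    (pi : {rmorphism path_algebra k Q -> A}) : Prop :=
  [/\ forall c x, pi (c *: x) = c *: pi x,
      forall y, exists x, pi x = y &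
      forall x, pi x = 0 <-> jacobian_ideal W x].

Definition admissible (A : algType k) (pi : path_algebra k Q -> A) (f : A -> A) : Prop :=
  [/\ forall i, exists j, f (pi (qidem k i)) = pi (qidem k j),
      forall a, exists b, f (pi (qarrow k a)) = pi (qarrow k b) &
      exists i, f (pi (qidem k i)) = pi (qidem k i)].

End Jacobian.

Record alg_action (k : comNzRingType) (gT : finGroupType) (A : algType k) := AlgAction {
  alg_act :> gT -> {lrmorphism A -> A};
  alg_act1 : forall a, alg_act 1%g a = a;
  alg_actM : forall g h a, alg_act (g * h)%g a = alg_act g (alg_act h a) }.

(* An element f of A (x) kG is encoded by its coordinates: f = sum_g f(g) (x) g. *)
Definition skew_algebra (k : comNzRingType) (gT : finGroupType) (A : algType k)
  (act : alg_action gT A) : Type := {ffun gT -> A}.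

Section Skew.
Variables (k : comNzRingType) (gT : finGroupType) (A : algType k).
Variable act : alg_action gT A.
Local Notation AG := (skew_algebra act).

HB.instance Definition _ := GRing.Lmodule.on AG.

Definition skew_tensor (a : A) (g : gT) : AG := [ffun x => if x == g then a else 0].

Definition skew_mul (f f' : AG) : AG :=
  [ffun x => \sum_g f g * act g (f' (g^-1 * x)%g)].

Lemma skew_tensorM a g a' g' :
  skew_mul (skew_tensor a g) (skew_tensor a' g') = skew_tensor (a * act g a') (g * g')%g.
Proof.
apply/ffunP => x; rewrite !ffunE (bigD1 g) //= big1 ?addr0 => [|h nh].
  rewrite !ffunE eqxx -(inj_eq (mulgI g)) mulKVg.
  by case: eqP => // _; rewrite raddf0 mulr0.
by rewrite !ffunE (negbTE nh) mul0r.
Qed.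

Fact skew_mulA : associative skew_mul.
Proof.
move=> u v w; apply/ffunP => x; rewrite !ffunE.
under eq_bigr => g _ do rewrite ffunE raddf_sum mulr_sumr.
under [RHS]eq_bigr => h _ do rewrite ffunE mulr_suml.
rewrite [RHS]exchange_big; apply: eq_bigr => g _ /=.
rewrite [RHS](reindex_inj (mulgI g)) /=; apply: eq_bigr => h _.
by rewrite mulKg alg_actM rmorphM mulrA invMg mulgA.
Qed.

Fact skew_mul1l : left_id (skew_tensor 1 1%g) skew_mul.
Proof.
move=> f; apply/ffunP => x; rewrite ffunE (bigD1 1%g) //= big1 ?addr0 => [|h nh].
  by rewrite ffunE eqxx mul1r alg_act1 invg1 mul1g.
by rewrite ffunE (negbTE nh) mul0r.
Qed.

Fact skew_mul1r : right_id (skew_tensor 1 1%g) skew_mul.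
Proof.
move=> f; apply/ffunP => x; rewrite ffunE (bigD1 x) //= big1 ?addr0 => [|h nh].
  by rewrite ffunE mulVg eqxx rmorph1 mulr1.
rewrite ffunE -(inj_eq (mulgI h)) mulKVg mulg1 eq_sym (negbTE nh).
by rewrite raddf0 mulr0.
Qed.

Fact skew_mulDl : left_distributive skew_mul +%R.
Proof.
move=> u v w; apply/ffunP => x; rewrite !ffunE -big_split /=.
by apply: eq_bigr => g _; rewrite ffunE mulrDl.
Qed.

Fact skew_mulDr : right_distributive skew_mul +%R.
Proof.
move=> u v w; apply/ffunP => x; rewrite !ffunE -big_split /=.
by apply: eq_bigr => g _; rewrite ffunE raddfD mulrDr.
Qed.

Fact skew_1neq0 : skew_tensor 1 1%g != 0.
Proof.
apply/eqP => /ffunP/(_ 1%g); rewrite !ffunE eqxx => /eqP.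
by rewrite oner_eq0.
Qed.

HB.instance Definition _ := GRing.Zmodule_isNzRing.Build AG
  skew_mulA skew_mul1l skew_mul1r skew_mulDl skew_mulDr skew_1neq0.

Fact skew_scaleAl (c : k) (u v : AG) : c *: (u * v) = (c *: u) * v.
Proof.
apply/ffunP => x; rewrite !ffunE scaler_sumr; apply: eq_bigr => g _.
by rewrite ffunE scalerAl.
Qed.
HB.instance Definition _ := GRing.Lmodule_isLalgebra.Build k AG skew_scaleAl.

Fact skew_scaleAr (c : k) (u v : AG) : c *: (u * v) = u * (c *: v).
Proof.
apply/ffunP => x; rewrite !ffunE scaler_sumr; apply: eq_bigr => g _.
by rewrite ffunE linearZ scalerAr.
Qed.
HB.instance Definition _ := GRing.Lalgebra_isAlgebra.Build k AG skew_scaleAr.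

Definition skew_incl (a : A) : AG := skew_tensor a 1%g.

End Skew.

(* A right A-module is a left module over the opposite ring A^c: m.a is written
   [(a : A^c) *: m].  The module [twist s M] is M with the action m.s(a). *)
Definition twist (k : comNzRingType) (A : algType k) (s : {lrmorphism A -> A})
  (M : lmodType A^c) : Type := M.

Section Twist.
Variables (k : comNzRingType) (A : algType k) (s : {lrmorphism A -> A}).
Variable M : lmodType A^c.
Local Notation sM := (twist s M).

HB.instance Definition _ := GRing.Zmodule.on sM.

Definition twist_scale (a : A^c) (m : sM) : sM := (s a : A^c) *: (m : M).

Fact twist_scaleA a b m : twist_scale a (twist_scale b m) = twist_scale (a * b) m.
Proof. by rewrite /twist_scale scalerA -[in RHS]/(s ((b : A) * (a : A))) rmorphM. Qed.
Fact twist_scale1 : left_id 1 twist_scale.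
Proof. by move=> m; rewrite /twist_scale rmorph1 scale1r. Qed.
Fact twist_scaleDr : right_distributive twist_scale +%R.
Proof. by move=> a m n; rewrite /twist_scale scalerDr. Qed.
Fact twist_scaleDl m : {morph twist_scale^~ m : a b / a + b}.
Proof. by move=> a b; rewrite /twist_scale rmorphD scalerDl. Qed.

HB.instance Definition _ := GRing.Zmodule_isLmodule.Build A^c sM
  twist_scaleA twist_scale1 twist_scaleDr twist_scaleDl.

End Twist.

Section Induction.
Variables (k : comNzRingType) (A B : algType k) (i : A -> B) (M : lmodType A^c).

Definition balanced (X : zmodType) (t : M -> B -> X) : Prop :=
  [/\ forall m m' x, t (m + m') x = t m x + t m' x,
      forall m x x', t m (x + x') = t m x + t m x' &
      forall m a x, t ((a : A^c) *: m) x = t m (i a * x)].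

(* T, together with t m x = m (x) x, is the tensor product of M and B over A
   (B being a left A-module through i), with its right B-module structure. *)
Definition is_tensor_product (T : lmodType B^c) (t : M -> B -> T) : Prop :=
  [/\ balanced t,
      forall m x y, t m (x * y) = (y : B^c) *: t m x &
      forall (X : zmodType) (u : M -> B -> X), balanced u ->
        exists2 h : {additive T -> X}, (forall m x, h (t m x) = u m x)
          & forall h' : {additive T -> X}, (forall m x, h' (t m x) = u m x) -> h' =1 h].

End Induction.

Section Modules.
Variable R : pzRingType.

Definition finitely_generated (M : lmodType R) : Prop :=
  exists n (g : 'I_n -> M), forall m, exists c : 'I_n -> R, m = \sum_i c i *: g i.

Definition surjective_map (X Y : Type) (f : X -> Y) : Prop := forall y, exists x, f x = y.

Definition projective (P : lmodType R) : Prop :=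
  forall (X Y : lmodType R) (g : {linear X -> Y}) (h : {linear P -> Y}),
    surjective_map g -> exists l : {linear P -> X}, forall p, g (l p) = h p.

Definition superfluous (P : lmodType R) (K : P -> Prop) : Prop :=
  forall L : {pred P}, submod_closed L ->
    (forall p, exists x y, [/\ K x, y \in L & p = x + y]) -> forall p, p \in L.

(* The exact sequence P1 -f-> P0 -p-> M -> 0 is a minimal projective
   presentation: P0 -> M and P1 -> ker p are projective covers. *)
Definition minimal_presentation (P1 P0 M : lmodType R)
    (f : {linear P1 -> P0}) (p : {linear P0 -> M}) : Prop :=
  [/\ finitely_generated P1 /\ finitely_generated P0,
      projective P1 /\ projective P0,
      surjective_map p /\ (forall x, p x = 0 <-> exists y, f y = x),
      superfluous (fun x => p x = 0) & superfluous (fun y => f y = 0)].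

Definition linear_hom (U V : lmodType R) : Type := {linear U -> V}.

Section LinearHom.
Variables U V : lmodType R.
Local Notation hom := (linear_hom U V).

Definition hom_fun (f : hom) : {linear U -> V} := f.

Lemma homP (f g : hom) : hom_fun f =1 hom_fun g -> f = g.
Proof.
case: f => f [af sf]; case: g => g [ag sg]; rewrite /hom_fun /= => /funext e.
subst g; case: af sf ag sg => af [sf] [ag] [sg].
by rewrite (Prop_irrelevance af ag) (Prop_irrelevance sf sg).
Qed.

HB.instance Definition _ := gen_eqMixin hom.
HB.instance Definition _ := gen_choiceMixin hom.

Definition hom_zero : hom := (\0 : {linear U -> V}).
Definition hom_opp (f : hom) : hom := (\- hom_fun f : {linear U -> V}).
Definition hom_add (f g : hom) : hom := (hom_fun f \+ hom_fun g : {linear U -> V}).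

Fact hom_addA : associative hom_add.
Proof. by move=> f g h; apply: homP => u; apply: addrA. Qed.
Fact hom_addC : commutative hom_add.
Proof. by move=> f g; apply: homP => u; apply: addrC. Qed.
Fact hom_add0 : left_id hom_zero hom_add.
Proof. by move=> f; apply: homP => u; apply: add0r. Qed.
Fact hom_addN : left_inverse hom_zero hom_opp hom_add.
Proof. by move=> f; apply: homP => u; apply: addNr. Qed.

HB.instance Definition _ :=
  GRing.isZmodule.Build hom hom_addA hom_addC hom_add0 hom_addN.

End LinearHom.
End Modules.

(* Hom_A(P, A), a left A-module through (a *: phi)(p) = a phi(p). *)
Definition right_dual (k : comNzRingType) (A : algType k) (P : lmodType A^c) : Type :=
  linear_hom P (A^c)^o.

Section RightDual.
Variables (k : comNzRingType) (A : algType k) (P : lmodType A^c).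
Local Notation Pd := (right_dual P).

HB.instance Definition _ := GRing.Zmodule.on Pd.

Definition rd_eval (phi : Pd) (p : P) : A := hom_fun phi p.

Section Scale.
Variables (a : A) (phi : Pd).
Definition rd_scale_fun (p : P) : (A^c)^o := (a * rd_eval phi p : A).
Fact rd_scale_linear : linear rd_scale_fun.
Proof.
move=> b p q; rewrite /rd_scale_fun /rd_eval linearP.
by rewrite (mulrDr (a : A)); congr (_ + _); apply: (mulrA (a : A)).
Qed.
HB.instance Definition _ :=
  GRing.isLinear.Build A^c P (A^c)^o _ rd_scale_fun rd_scale_linear.
Definition rd_scale : Pd := (rd_scale_fun : {linear P -> (A^c)^o}).
End Scale.

Fact rd_scaleA a b phi : rd_scale a (rd_scale b phi) = rd_scale (a * b) phi.
Proof. by apply: homP => p; apply: (mulrA (a : A)). Qed.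
Fact rd_scale1 : left_id 1 rd_scale.
Proof. by move=> phi; apply: homP => p; apply: (mul1r (_ : A)). Qed.
Fact rd_scaleDr : right_distributive rd_scale +%R.
Proof. by move=> a phi psi; apply: homP => p; apply: (mulrDr (a : A)). Qed.
Fact rd_scaleDl phi : {morph rd_scale^~ phi : a b / a + b}.
Proof. by move=> a b; apply: homP => p; apply: (mulrDl (a : A)). Qed.

HB.instance Definition _ := GRing.Zmodule_isLmodule.Build A Pd
  rd_scaleA rd_scale1 rd_scaleDr rd_scaleDl.

End RightDual.

Definition restrict_scalars (k : comNzRingType) (A : algType k) (N : lmodType A) : Type := N.

Section Restrict.
Variables (k : comNzRingType) (A : algType k) (N : lmodType A).
Local Notation Nk := (restrict_scalars N).

HB.instance Definition _ := GRing.Zmodule.on Nk.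

Definition rs_scale (c : k) (n : Nk) : Nk := (c%:A : A) *: (n : N).

Fact rs_scaleA c d n : rs_scale c (rs_scale d n) = rs_scale (c * d) n.
Proof. by rewrite /rs_scale scalerA -scalerAl mul1r scalerA. Qed.
Fact rs_scale1 : left_id 1 rs_scale.
Proof. by move=> n; rewrite /rs_scale !scale1r. Qed.
Fact rs_scaleDr : right_distributive rs_scale +%R.
Proof. by move=> c m n; rewrite /rs_scale scalerDr. Qed.
Fact rs_scaleDl n : {morph rs_scale^~ n : c d / c + d}.
Proof. by move=> c d; rewrite /rs_scale !scalerDl. Qed.

HB.instance Definition _ := GRing.Zmodule_isLmodule.Build k Nk
  rs_scaleA rs_scale1 rs_scaleDr rs_scaleDl.
End Restrict.

(* D N = Hom_k(N, k), a right A-module through (xi.a)(n) = xi (a n). *)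
Definition kdual (k : comNzRingType) (A : algType k) (N : lmodType A) : Type :=
  linear_hom (restrict_scalars N) k^o.

Section KDual.
Variables (k : comNzRingType) (A : algType k) (N : lmodType A).
Local Notation DN := (kdual N).

HB.instance Definition _ := GRing.Zmodule.on DN.

Definition kd_eval (xi : DN) (n : N) : k := hom_fun xi n.

Section Scale.
Variables (a : A^c) (xi : DN).
Definition kd_scale_fun (n : restrict_scalars N) : k^o := kd_eval xi ((a : A) *: (n : N)).
Fact kd_scale_linear : linear kd_scale_fun.
Proof.
move=> c m n; rewrite /kd_scale_fun /kd_eval -linearP; congr (hom_fun xi _).
rewrite [LHS]scalerDr; congr (_ + _).
change ((a : A) *: ((c%:A : A) *: (m : N)) = (c%:A : A) *: ((a : A) *: (m : N))).
by rewrite !scalerA -scalerAl -scalerAr mulr1 mul1r.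
Qed.
HB.instance Definition _ :=
  GRing.isLinear.Build k (restrict_scalars N) k^o _ kd_scale_fun kd_scale_linear.
Definition kd_scale : DN := (kd_scale_fun : {linear restrict_scalars N -> k^o}).
End Scale.

Fact kd_scaleA a b xi : kd_scale a (kd_scale b xi) = kd_scale (a * b) xi.
Proof.
by apply: homP => n; rewrite /= /kd_scale_fun /kd_eval /= /kd_scale_fun scalerA.
Qed.
Fact kd_scale1 : left_id 1 kd_scale.
Proof. by move=> xi; apply: homP => n; rewrite /= /kd_scale_fun scale1r. Qed.
Fact kd_scaleDr : right_distributive kd_scale +%R.
Proof. by move=> a xi zeta; apply: homP. Qed.
Fact kd_scaleDl xi : {morph kd_scale^~ xi : a b / a + b}.
Proof.
move=> a b; apply: homP => n; rewrite /= /kd_scale_fun /kd_eval scalerDl.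
exact: (raddfD (hom_fun xi)).
Qed.

HB.instance Definition _ := GRing.Zmodule_isLmodule.Build A^c DN
  kd_scaleA kd_scale1 kd_scaleDr kd_scaleDl.

End KDual.

Section AuslanderReiten.
Variables (k : comNzRingType) (A : algType k).

(* N is Tr M: the cokernel of Hom_A(f, A) : Hom_A(P0, A) -> Hom_A(P1, A) for a
   minimal projective presentation P1 -f-> P0 -> M -> 0. *)
Definition is_transpose (M : lmodType A^c) (N : lmodType A) : Prop :=
  exists (P1 P0 : lmodType A^c) (f : {linear P1 -> P0}) (p : {linear P0 -> M})
         (q : {linear right_dual P1 -> N}),
    [/\ minimal_presentation f p,
        surjective_map q &
        forall phi : right_dual P1, q phi = 0 <->
          exists psi : right_dual P0, forall x, rd_eval phi x = rd_eval psi (f x)].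

(* Here [kdual N] = D Tr M is tau M.  Minimal projective presentations of a module
   over a finite-dimensional algebra exist and are unique up to isomorphism, and
   so is N. *)
Definition tau_rigid (M : lmodType A^c) : Prop :=
  exists N : lmodType A,
    is_transpose M N /\ forall h : {linear M -> kdual N}, forall m, h m = 0.

End AuslanderReiten.

(* Main.v *)
Require Import Defs.
From HB Require Import structures.
From mathcomp Require Import all_boot all_order all_fingroup all_algebra.
From mathcomp Require Import zify.
From mathcomp Require Import boolp.
From mathcomp Require classical_sets.

(** Write X for the direct sum of M and sigma M, and B for AG.

    By Auslander-Reiten duality, a module with a minimal projective presentation
    f : P1 -> P0 is tau-rigid if and only if every map from P1 to the module factors
    through f ([tau_rigidP]).  The proposition compares this property over A and over B.

    Since sigma has order two, a B-module is an A-module with a sigma-semilinear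
    involution, and the B-linear maps are the A-linear maps that commute with the
    involutions.  As 2 is invertible, every A-linear map between B-modules is the sum of
    an even part, which commutes with the involutions, and of an odd part, which
    anticommutes with them.  The restriction of FM to A is X with the involution that
    exchanges the summands, and the sign change eps of the second summand turns odd maps
    to FM into even ones ([tau_rigid_induced]).

    From B to A ([tau_rigid_restrict]): a minimal presentation f of FM stays minimal over
    A.  What has to be seen is that a superfluous B-submodule K of a projective P is
    superfluous over A, that is, that 1 - phi is onto for every A-linear phi from P to K.
    If a and b are the even and odd parts of phi, then 1 - a is onto because a is
    B-linear, hence has a right inverse v; and for the odd map b' = b v, the product
    (1 - b')(1 + b') = 1 - b'^2 is onto because b'^2 is even.  Now if g is an A-linear map
    to FM with even and odd parts g0 and g1, then g0 and eps g1 factor through f over B,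
    so that g factors through f over A.

    From A to B ([tau_rigid_extend]): the involution of X lifts to a semilinear map S of
    P0, and then of P1, with S^2 = 1 + d where d takes its values in a superfluous
    submodule.  As A is finite-dimensional over an algebraically closed field, d is
    nilpotent ([superfluous_nilpotent]), and replacing S by S (3 - S^2) / 2 finitely often
    yields an involution ([lift_involution]).  The minimal presentation of X thus becomes
    one of B-modules, and factorisations over A become B-linear on averaging them.

    That A is finite-dimensional ([jacobian_finite_span]) is shown by gluing the chordless
    cycles one at a time along the dual tree, each one along a single arrow
    ([grown_all]).  Every gluing adds at most the length of the cycle minus 2 new
    vertices; the boundary being a simple cycle, there are at least as many vertices as
    boundary arrows, and comparing the two counts shows that a glued cycle meets the
    earlier ones in the two ends of the shared arrow only ([grown_vertices_eq]).  Apart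
    from its two extremities, a path therefore runs through a glued cycle from one end of
    the shared arrow to the other, and the Jacobian relation at the shared arrow replaces
    this passage, up to sign, by a path of the earlier cycles.  Inductively, only finitely
    many elements of A are products of arrows ([grown_finite_products]). *)

Set Implicit Arguments.
Unset Strict Implicit.
Unset Printing Implicit Defensive.

Import GRing.Theory.
Local Open Scope ring_scope.

(** * Rings in which a list of elements has finitely many products *)

Section FiniteProducts.
Variable R : pzRingType.
Implicit Types (L X s : seq R) (b : R).

Definition finite_products L : Prop :=
  exists X, forall s, {subset s <= L} -> \prod_(x <- s) x \in X.

Lemma finite_products_sub L L' :
  {subset L' <= L} -> finite_products L -> finite_products L'.
Proof. by move=> sL [X XP]; exists X => s sL'; apply: XP => x /sL'/sL. Qed.

Lemma finite_products_nilpotent b c :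
  b * b = 0 -> b * c = 0 -> c * b = 0 -> c * c = 0 -> finite_products [:: b; c].
Proof.
move=> bb bc cb cc; exists [:: 0; 1; b; c] => -[|x [|y s]] sL.
- by rewrite big_nil !inE eqxx orbT.
- have := sL x (mem_head _ _).
  by rewrite big_seq1 !inE => /orP [] /eqP ->; rewrite eqxx ?orbT.
have := sL x (mem_head _ _); have : y \in [:: b; c] by apply: sL; rewrite !inE eqxx orbT.
rewrite !big_cons mulrA !inE => /orP [] /eqP -> /orP [] /eqP ->;
  by rewrite ?bb ?bc ?cb ?cc mul0r eqxx.
Qed.

(** Used to replace the passage through a cycle by a path of other cycles, to which the
    Jacobian relation equates it up to sign. *)
Lemma finite_products_signed_word L s b : {subset s <= L} ->
  b = \prod_(x <- s) x \/ b = - \prod_(x <- s) x ->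
  finite_products L -> finite_products (b :: L).
Proof.
move=> sL bE [X XP]; exists (X ++ map -%R X) => r rL.
suff [r' r'L [->|->]] : exists2 r', {subset r' <= L} &
    \prod_(x <- r) x = \prod_(x <- r') x \/ \prod_(x <- r) x = - \prod_(x <- r') x.
- by rewrite mem_cat XP.
- by rewrite mem_cat map_f ?orbT // XP.
elim: r rL => [|x r IH] rL; first by exists [::] => //; left.
have [y yr|r' r'L r'E] := IH; first by apply: rL; rewrite inE yr orbT.
rewrite big_cons; have := rL x (mem_head _ _); rewrite inE => /orP [/eqP ->|xL].
- exists (s ++ r'); first by move=> y; rewrite mem_cat => /orP [/sL|/r'L].
  rewrite big_cat /=; case: bE r'E => [->|->] [->|->]; rewrite ?mulNr ?mulrN ?opprK; auto.
- exists (x :: r'); first by move=> y; rewrite inE => /orP [/eqP ->|/r'L].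
  by rewrite big_cons; case: r'E => ->; [left|right; rewrite mulrN].
Qed.

(** If b1 can only be followed by b2, and b2 only preceded by b1, then in a nonzero
    product the two occur as the block b1 b2, except for a b2 at the very beginning and a
    b1 at the very end. *)
Lemma finite_products_merge b1 b2 L :
  b1 * b1 = 0 -> (forall c, c \in L -> b1 * c = 0) ->
  b2 * b2 = 0 -> (forall c, c \in L -> c * b2 = 0) ->
  finite_products (b1 * b2 :: L) -> finite_products [:: b1, b2 & L].
Proof.
move=> b11 b1L b22 Lb2 [X XP].
exists (0 :: [seq pq.1 * y * pq.2 | pq <- [:: (1, 1); (1, b1); (b2, 1); (b2, b1)], y <- X]) => s sL.
suff : \prod_(x <- s) x = 0 \/ exists p q r,
    [/\ p \in [:: 1; b2], q \in [:: 1; b1], {subset r <= b1 * b2 :: L} &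
        \prod_(x <- s) x = p * \prod_(x <- r) x * q].
  case=> [->|[p [q [r [pP qP rL ->]]]]]; first exact: mem_head.
  rewrite inE; apply/orP; right; apply/allpairsP; exists ((p, q), \prod_(x <- r) x).
  split=> //=; last exact: XP.
  by move: pP qP; rewrite !inE => /orP [] /eqP -> /orP [] /eqP ->; rewrite eqxx ?orbT.
elim: s sL => [|a s IH] sL.
  right; exists 1, 1, [::]; split=> //; rewrite ?mem_head //.
  by rewrite !big_nil !mul1r.
rewrite big_cons.
have [y ys|->|[p [q [r [pP qP rL ->]]]]] := IH; first by apply: sL; rewrite inE ys orbT.
  by rewrite mulr0; left.
have := sL a (mem_head _ _); rewrite !inE => /or3P [/eqP ->|/eqP ->|aL].
- move: pP; rewrite !inE => /orP [] /eqP ->.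
    case: r rL => [|c r] rL.
      rewrite big_nil !mul1r; move: qP; rewrite !inE => /orP [] /eqP ->.
        right; exists 1, b1, [::]; rewrite !inE !eqxx ?orbT; split=> //.
        by rewrite big_nil mulr1 !mul1r.
      by rewrite b11; left.
    left; rewrite mul1r big_cons !mulrA.
    have := rL c (mem_head _ _); rewrite inE => /orP [/eqP ->|/b1L ->]; last by rewrite !mul0r.
    by rewrite mulrA b11 !mul0r.
  right; exists 1, q, (b1 * b2 :: r); rewrite inE eqxx; split=> //.
    by move=> y; rewrite inE => /orP [/eqP ->|/rL //]; apply: mem_head.
  by rewrite big_cons mul1r !mulrA.
- move: pP; rewrite !inE => /orP [] /eqP ->; last by left; rewrite !mulrA b22 !mul0r.
  by right; exists b2, q, r; split=> //; [rewrite !inE eqxx orbT|rewrite mul1r !mulrA].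
- move: pP; rewrite !inE => /orP [] /eqP ->; last by left; rewrite !mulrA Lb2 // !mul0r.
  right; exists 1, q, (a :: r); split=> //; first exact: mem_head.
    by move=> y; rewrite !inE => /orP [/eqP ->|/rL]; rewrite ?aL ?orbT // inE.
  by rewrite big_cons !mul1r !mulrA.
Qed.

End FiniteProducts.

Section Words.
Variables (R : pzRingType) (Q : quiver) (x : arrow Q -> R).
Hypothesis x_comp : forall a b, tgt a != src b -> x a * x b = 0.
Hypothesis loopless : no_loops Q.

Definition word_val (s : seq (arrow Q)) : R := \prod_(a <- s) x a.

Lemma word_val_cat s t : word_val (s ++ t) = word_val s * word_val t.
Proof. exact: big_cat. Qed.

Lemma word_val_cons a s : word_val (a :: s) = x a * word_val s.
Proof. exact: big_cons. Qed.

Lemma word_val_rcons s a : word_val (rcons s a) = word_val s * x a.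
Proof. by rewrite -cats1 word_val_cat /word_val big_seq1. Qed.

(** A path whose inner vertices lie on no other arrow can be treated as a single letter:
    its arrows are absorbed one by one into the prefix rcons p z. *)
Lemma finite_products_contract (S : seq (arrow Q)) v p z bs :
  path (fun a b => tgt a == src b) z bs ->
  uniq (map (@src Q) bs) -> uniq (map (@tgt Q) (z :: bs)) ->
  src (head z p) = v -> (forall c, c \in z :: bs -> tgt c != v) ->
  (forall y c, y \in bs -> c \in S -> src c != src y /\ tgt c != src y) ->
  finite_products (word_val (rcons p z ++ bs) :: map x S) ->
  finite_products (word_val (rcons p z) :: map x bs ++ map x S).
Proof.
elim: bs p z => [|y r IH] p z; first by rewrite cats0.
move=> /= /andP [/eqP zy pr] /andP [yr ur] /and3P [zt yt ut] hv nv newS FPbig.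
have {}FPbig : finite_products (word_val (rcons (rcons p z) y) :: map x r ++ map x S).
  apply: IH => //=.
  - by rewrite yt.
  - by rewrite -hv; case: (p).
  - by move=> c cr; apply: nv; rewrite inE cr orbT.
  - by move=> y' c y'r; apply: newS; rewrite inE y'r orbT.
  - by rewrite cat_rcons.
rewrite word_val_rcons in FPbig.
have pz c : src c != src y -> word_val (rcons p z) * x c = 0.
  by move=> ne; rewrite word_val_rcons -mulrA x_comp ?mulr0 // zy eq_sym.
have yc c : tgt c != src y -> x c * x y = 0 by apply: x_comp.
apply: finite_products_merge => //.
- have pE : word_val (rcons p z) = x (head z p) * word_val (behead (rcons p z)).
    by rewrite -word_val_cons; case: (p).
  rewrite {2}pE mulrA pz ?mul0r // hv -zy eq_sym; apply: nv; exact: mem_head.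
- move=> c; rewrite mem_cat => /orP [] /mapP [c' c'in ->]; apply: pz.
    by apply: contraNneq yr => <-; apply: map_f.
  by have [] := newS y c' (mem_head _ _) c'in.
- by apply: yc; rewrite eq_sym loopless.
- move=> c; rewrite mem_cat => /orP [] /mapP [c' c'in ->]; apply: yc.
    by rewrite -zy; apply: contraNneq zt => <-; rewrite inE map_f ?orbT.
  by have [] := newS y c' (mem_head _ _) c'in.
Qed.

End Words.

(** * Cyclic words of chordless cycles and the Jacobian relations *)

Lemma uniq_map_inj_in (T1 T2 : eqType) (f : T1 -> T2) (s : seq T1) :
  uniq (map f s) -> {in s &, injective f}.
Proof.
move=> un a b ain bin fab; have := nth_uniq (f a) _ _ un.
move=> /(_ (index a s) (index b s)); rewrite !size_map !index_mem => /(_ ain bin).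
rewrite !(nth_map a) ?index_mem // !nth_index // fab eqxx => /esym/eqP e.
by rewrite -(nth_index a ain) e nth_index.
Qed.

Section Cycles.
Import classical_sets.
Variable Q : quiver.
Local Notation Q1 := (arrow Q).
Implicit Types (C : {set Q1}) (a b : Q1) (c s r : seq Q1).

(** Words representing the cyclic path with set of arrows C; they differ by rotation only. *)
Definition cycle_list C c : Prop := is_chordless_cycle c /\ C = [set a in c]%SET.

Lemma cycle_list_rot n C c : cycle_list C c -> cycle_list C (rot n c).
Proof.
move=> [/and4P [c0 cyc un full] ->]; split; last by apply/setP => a; rewrite !inE mem_rot.
apply/and4P; split; rewrite ?rot_cycle // ?map_rot ?rot_uniq //.
  by rewrite -size_eq0 size_rot size_eq0.
apply/forallP => a; have := forallP full a; rewrite !mem_rot.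
by [].
Qed.

Lemma cycle_list_rotl C a b r : cycle_list C (a :: b :: r) -> cycle_list C (b :: rcons r a).
Proof. by move=> /(cycle_list_rot 1); rewrite rot1_cons. Qed.

Lemma cycle_list_rotr C a b r : cycle_list C (a :: rcons r b) -> cycle_list C (b :: a :: r).
Proof.
move=> /(cycle_list_rot (size (a :: r))); rewrite -rcons_cons -cats1 rot_size_cat.
by [].
Qed.

Lemma cycle_list_mem C c : cycle_list C c -> C =i c.
Proof. by move=> [_ ->] a; rewrite inE. Qed.

Lemma cycle_list_uniq C c : cycle_list C c -> uniq (map (@src Q) c).
Proof. by move=> [/and4P []]. Qed.

Lemma cycle_list_tgt C c : cycle_list C c -> map (@tgt Q) c = rot 1 (map (@src Q) c).
Proof.
move=> [/and4P [c0 cyc _ _] _]; case: c c0 cyc => // a s _ /=.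
rewrite rot1_cons.
suff H z : path (fun a b => tgt a == src b) a (rcons s z) ->
    tgt a :: map (@tgt Q) s = rcons (map (@src Q) s) (src z) by exact: H.
by elim: s a => [|b s IH] a /=; [move=> /andP [/eqP ->]|move=> /andP [/eqP -> /IH ->]].
Qed.

Lemma cycle_list_tgt_uniq C c : cycle_list C c -> uniq (map (@tgt Q) c).
Proof. by move=> cC; rewrite (cycle_list_tgt cC) rot_uniq (cycle_list_uniq cC). Qed.

(** A cycle visits a vertex only once, so the next arrow is determined by its source. *)
Lemma cycle_list_det C a s r : cycle_list C (a :: s) -> cycle_list C (a :: r) -> s = r.
Proof.
move=> cs cr.
have us := map_uniq (cycle_list_uniq cs); have ur := map_uniq (cycle_list_uniq cr).
have memE : a :: s =i a :: r.
  by move=> b; rewrite -(cycle_list_mem cs) (cycle_list_mem cr).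
have /eqP : size (a :: s) = size (a :: r) by apply/eqP; rewrite -uniq_size_uniq.
rewrite /= eqSS => /eqP sz.
have inj b b' : b \in C -> b' \in C -> src b = src b' -> b = b'.
  rewrite !(cycle_list_mem cs) => bs bs'.
  exact: uniq_map_inj_in (cycle_list_uniq cs) b b' bs bs'.
have sC b : b \in s -> b \in C by move=> bs; rewrite (cycle_list_mem cs) inE bs orbT.
have rC b : b \in r -> b \in C by move=> br; rewrite (cycle_list_mem cr) inE br orbT.
have ps : path (fun a b => tgt a == src b) a s.
  by case: cs => /and4P [_ + _ _] _; rewrite /= rcons_path => /andP [].
have pr : path (fun a b => tgt a == src b) a r.
  by case: cr => /and4P [_ + _ _] _; rewrite /= rcons_path => /andP [].
elim: s r sz a ps pr sC rC {cs cr us ur memE} => [|b s IH] [|b' r] //= [sz] a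
  /andP [/eqP e ps] /andP [/eqP e' pr] sC rC.
have bb' : b = b' by apply: inj; [apply/sC/mem_head|apply/rC/mem_head|rewrite -e].
rewrite -bb' in pr *; congr (_ :: _); apply: (IH _ sz b) => // d din.
  by apply: sC; rewrite inE din orbT.
by apply: rC; rewrite inE din orbT.
Qed.

(** The word by which [Defs.cycle_path] represents C in the potential. *)
Definition cycle_word C : seq Q1 :=
  xget [::] [set c | is_chordless_cycle c /\ C = [set a in c]%SET]%classic.

Lemma cycle_wordP C : C \in chordless_cycles Q -> cycle_list C (cycle_word C).
Proof.
rewrite inE => /asboolP [c cc cE].
by rewrite /cycle_word; case: xgetP => // /(_ c) [].
Qed.

(** The path that closes the arrow a to the cycle C; it leads from the target of a to its
    source. *)
Definition co_path C a : seq Q1 :=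
  let c := cycle_word C in drop (index a c).+1 c ++ take (index a c) c.

Lemma co_pathP C a : C \in chordless_cycles Q -> a \in C -> cycle_list C (a :: co_path C a).
Proof.
move=> /cycle_wordP cC aC; have ac : a \in cycle_word C by rewrite -(cycle_list_mem cC).
have := cycle_list_rot (index a (cycle_word C)) cC.
by rewrite /rot (drop_nth a) ?index_mem // nth_index.
Qed.

Lemma co_path_eq C a s : C \in chordless_cycles Q -> cycle_list C (a :: s) -> co_path C a = s.
Proof.
move=> CC cs; apply: (cycle_list_det _ cs); apply: co_pathP => //.
by rewrite (cycle_list_mem cs) mem_head.
Qed.

Lemma is_qpath_path a s :
  is_qpath (tgt a) s = path (fun a b => tgt a == src b) a s.
Proof. by elim: s a => //= b s IH a; rewrite IH eq_sym. Qed.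

Lemma cycle_list_path C a s : cycle_list C (a :: s) ->
  path (fun a b => tgt a == src b) a s /\ tgt (last a s) = src a.
Proof.
by case=> /and4P [_ + _ _] _; rewrite /= rcons_path => /andP [? /eqP].
Qed.

End Cycles.

Section JacobianRelations.
Variables (k : fieldType) (Q : quiver).
Local Notation Q1 := (arrow Q).

Lemma cyclic_derivative_cycle_path (C : {set Q1}) a : C \in chordless_cycles Q ->
  cyclic_derivative a (Defs.cycle_path k C) =
  if a \in C then qword k (tgt a) (co_path C a) else 0.
Proof.
move=> CC; have cC := cycle_wordP CC; rewrite (cycle_list_mem cC).
rewrite /Defs.cycle_path -/(cycle_word C) /co_path.
case: (cycle_word C) cC => [[]//|a0 s] cC.
have [ps es] := cycle_list_path cC.
have qp : is_qpath (src a0) (a0 :: s) by rewrite /= eqxx is_qpath_path.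
have [p -> pE] := qwordT k qp; rewrite qbasis.unlock /cyclic_derivative malg_liftU.
rewrite /qend /qstart /qarrows pE /= last_map es eqxx.
have un := map_uniq (cycle_list_uniq cC).
have [ain|ain] := boolP (a \in a0 :: s).
  have lt : (index a (a0 :: s) < (size s).+1)%N.
    by rewrite -[X in (_ < X)%N]/(size (a0 :: s)) index_mem.
  rewrite (big_pred1 (Ordinal lt)) // => j /=.
  apply/eqP/eqP => [e|->]; last by rewrite /= nth_index.
  apply: val_inj; change (j = index a (a0 :: s) :> nat).
  by rewrite -[X in index X]e index_uniq.
rewrite big1 // => j /eqP e; case/negP: ain; rewrite -e.
exact: mem_nth.
Qed.

Variables (A : algType k) (pi : {rmorphism path_algebra k Q -> A}).
Local Notation x a := (pi (qarrow k a)).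

Lemma qarrow_idem (a : Q1) : qarrow k a * qidem k (tgt a) = qarrow k a.
Proof. by rewrite -[LHS]/(qmul _ _) qmulW /= ?eqxx. Qed.

Lemma qidem_qarrow (a : Q1) : qidem k (src a) * qarrow k a = qarrow k a.
Proof. by rewrite -[LHS]/(qmul _ _) qmulW /= ?eqxx. Qed.

Lemma qarrow_comp (a b : Q1) : tgt a != src b -> x a * x b = 0.
Proof.
move=> ne; rewrite -rmorphM -[_ * _]/(qmul _ _) qmulW /= ?eqxx //.
by rewrite (negbTE ne) rmorph0.
Qed.

Lemma pi_qword i (s : seq Q1) : is_qpath i s ->
  pi (qword k i s) = pi (qidem k i) * word_val (fun a => x a) s.
Proof.
elim: s i => [|a s IH] i; first by rewrite /word_val big_nil mulr1.
move=> /= /andP [/eqP <- ps].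
have -> : qword k (src a) (a :: s) = qarrow k a * qword k (tgt a) s.
  by rewrite -[RHS]/(qmul _ _) qmulW /= ?eqxx.
rewrite rmorphM IH // mulrA -rmorphM qarrow_idem word_val_cons mulrA -rmorphM.
by rewrite qidem_qarrow.
Qed.

(** The vertex idempotent in front is absorbed by the first arrow: without loops the
    path closing a cycle is not trivial. *)
Lemma pi_co_path (C : {set Q1}) a : no_loops Q -> C \in chordless_cycles Q -> a \in C ->
  pi (qword k (tgt a) (co_path C a)) = word_val (fun a => x a) (co_path C a).
Proof.
move=> nl CC aC; have [ps es] := cycle_list_path (co_pathP CC aC).
rewrite pi_qword ?is_qpath_path //.
case: (co_path C a) ps es => [_ /= e|b s /= /andP [/eqP -> _] _].
  by have := nl a; rewrite e eqxx.
by rewrite word_val_cons mulrA -rmorphM qidem_qarrow.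
Qed.

Variable C0 : {set Q1}.
Hypothesis jac : is_jacobian_algebra (potential k C0) pi.
Hypothesis nl : no_loops Q.

(** The image in A of the cyclic derivative of the potential at a. *)
Lemma jacobian_relation a :
  \sum_(C in cycles_through a) (-1) ^+ mdist (dual_graph Q) (inl C) (inl C0) *:
     word_val (fun a => x a) (co_path C a) = 0.
Proof.
have [piZ _ piker] := jac.
have : pi (cyclic_derivative a (potential k C0)) = 0.
  by apply/piker; exists [:: (1, a, 1)]; rewrite big_seq1 mul1r mulr1.
have -> : cyclic_derivative a (potential k C0) = \sum_(C in chordless_cycles Q)
    (-1) ^+ mdist (dual_graph Q) (inl C) (inl C0) *: cyclic_derivative a (Defs.cycle_path k C).
  rewrite /potential /cyclic_derivative linear_sum; apply: eq_bigr => C _.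
  by rewrite linearZ.
rewrite rmorph_sum /= => e.
rewrite -[RHS]e [RHS](bigID (fun C : {set Q1} => a \in C)) /= [X in _ + X]big1 ?addr0.
  rewrite [LHS](eq_bigl (fun C : {set Q1} => (C \in chordless_cycles Q) && (a \in C))); last first.
    by move=> C; rewrite inE.
  apply: eq_bigr => C /andP [CC aC].
  rewrite piZ cyclic_derivative_cycle_path // aC.
  by rewrite pi_co_path.
move=> C /andP [CC aC].
rewrite piZ cyclic_derivative_cycle_path // (negbTE aC).
by rewrite rmorph0 scaler0.
Qed.

End JacobianRelations.

(** * Gluing the chordless cycles along the dual tree *)

Lemma next_next_neq (T : eqType) (l : seq T) x :
  uniq l -> (2 < size l)%N -> x \in l -> next l (next l x) != x.
Proof.
move=> ul sl xl; have [i s sE] := rot_to xl.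
have us : uniq (x :: s) by rewrite -sE rot_uniq.
rewrite -(next_rot i ul) -[next l x](next_rot i ul) sE.
have : (2 < size (x :: s))%N by rewrite -sE size_rot.
case: s us {sE} => [|y [|z s]] //= us _.
case/and4P: us; rewrite !inE !negb_or => /and3P [xy xz _] _ _ _.
by rewrite eqxx [y == x]eq_sym (negbTE xy) eqxx eq_sym.
Qed.

Section DualTree.
Local Open Scope nat_scope.
Variable Q : quiver.
Local Notation Q1 := (arrow Q).
Local Notation G := (dual_graph Q).
Hypothesis treeG : mtree G.
Implicit Types (C D : {set Q1}) (a b : Q1) (l : seq {set Q1}).

Lemma mem_cycles_through C a :
  (C \in cycles_through a) = (C \in chordless_cycles Q) && (a \in C).
Proof. by rewrite inE. Qed.

Lemma dual_edge C D a : C \in chordless_cycles Q -> D \in chordless_cycles Q ->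
  C != D -> a \in C -> a \in D -> (a, [set inl C; inl D]) \in medges G.
Proof.
move=> CC DD CD aC aD; rewrite inE; apply/existsP; exists C.
rewrite mem_cycles_through CC aC /=; apply/orP; left; apply/existsP; exists D.
by rewrite mem_cycles_through DD aD CD eqxx.
Qed.

Lemma dual_vertex C : C \in chordless_cycles Q -> inl C \in mverts G.
Proof. by move=> CC; rewrite inE. Qed.

Lemma set2_inl_inj C C' D D' :
  [set inl C; inl C'] = [set inl D; inl D'] :> {set ({set Q1} + Q1)%type} ->
  C = D \/ (C = D' /\ C' = D).
Proof.
move=> e.
have : inl C \in ([set inl D; inl D'] : {set ({set Q1} + Q1)%type}) by rewrite -e !inE eqxx.
rewrite !inE => /orP [/eqP [->]|/eqP [CD]]; first by left.
have : inl D \in ([set inl C; inl C'] : {set ({set Q1} + Q1)%type}) by rewrite e !inE eqxx.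
by rewrite !inE => /orP [/eqP [->]|/eqP [->]]; [left|right].
Qed.

(** A closed chain of distinct chordless cycles, each sharing an arrow with the next one,
    is a simple cycle of the dual tree.  With at least three of them, the edges are told
    apart by their end points, whatever the labels. *)
Lemma dual_no_long_cycle l (e : {set Q1} -> Q1) : uniq l -> 2 < size l ->
  {subset l <= chordless_cycles Q} ->
  (forall C, C \in l -> e C \in C /\ e C \in next l C) -> False.
Proof.
move=> ul sl lC eP; have [_] := treeG.
move=> /(_ [seq (inl C, (e C, [set inl C; inl (next l C)])) | C <- l]).
case/negP; have nl C : C \in l -> next l C \in l by rewrite mem_next.
have nn C : C \in l -> C != next l C.
  move=> Cl; apply/eqP => nE; have := next_next_neq ul sl Cl.
  by rewrite -!nE eqxx.
apply/and5P; split.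
- by case: l sl {ul lC eP nl nn}.
- by rewrite -map_comp map_inj_uniq // => C D [].
- rewrite -map_comp map_inj_in_uniq // => C D Cl Dl [_ /set2_inl_inj [//|[CD DC]]].
  by have := next_next_neq ul sl Cl; rewrite DC -CD eqxx.
- apply/allP => _ /mapP [C Cl ->] /=; have [eC en] := eP C Cl.
  by rewrite dual_vertex ?lC // dual_edge ?lC ?nl ?nn.
- have := cycle_next ul; rewrite cycle_map; apply: sub_cycle => C D /= /eqP <-.
  exact: eqxx.
Qed.

(** Two shared arrows would be two parallel edges. *)
Lemma dual_share_one C D a b : C \in chordless_cycles Q -> D \in chordless_cycles Q ->
  C != D -> a \in C -> a \in D -> b \in C -> b \in D -> a = b.
Proof.
move=> CC DD CD aC aD bC bD; apply/eqP; apply: contraT => ab.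
have [_ /(_ [:: (inl C, (a, [set inl C; inl D])); (inl D, (b, [set inl D; inl C]))])] := treeG.
case/negP; apply/and5P; split=> //=.
- by rewrite inE andbT; apply: contraNneq CD => -[->].
- by rewrite inE andbT; apply: contraNneq ab => -[->].
- by rewrite !dual_vertex // !dual_edge // eq_sym.
- by rewrite !eqxx.
Qed.

End DualTree.

Section Growth.
Local Open Scope nat_scope.
Variable Q : quiver.
Local Notation Q1 := (arrow Q).
Local Notation G := (dual_graph Q).
Hypothesis treeG : mtree G.
Implicit Types (C D : {set Q1}) (a b : Q1) (T : {set {set Q1}}).

Definition share T : rel {set Q1} :=
  fun C D => [&& C \in T, D \in T & [exists a, (a \in C) && (a \in D)]].

(** Sets of chordless cycles obtained by gluing one cycle at a time along one arrow. *)
Inductive grown : {set {set Q1}} -> Prop :=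
| grown1 C : C \in chordless_cycles Q -> grown [set C]
| grownU T C D a : grown T -> C \in chordless_cycles Q -> C \notin T ->
    D \in T -> a \in D -> C :&: cover T = [set a] -> grown (C |: T).

Lemma grown_sub T : grown T -> T \subset chordless_cycles Q.
Proof.
elim=> [C CC|T' C D a _ sub CC _ _ _ _]; first by rewrite sub1set.
by rewrite subUset sub1set CC.
Qed.

Lemma share_sym T : symmetric (share T).
Proof.
move=> C D; rewrite /share; case: (C \in T) => //; case: (D \in T) => //=.
by apply: eq_existsb => a; rewrite andbC.
Qed.

Lemma share_mono T T' C D : T \subset T' -> connect (share T) C D -> connect (share T') C D.
Proof.
move=> /subsetP sub; apply: connect_sub => {}C {}D /and3P [CT DT ex].
by apply: connect1; rewrite /share !sub.
Qed.

Lemma grown_connected T : grown T -> {in T &, forall C D, connect (share T) C D}.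
Proof.
elim=> [C CC|T' C D a _ conn CC CT DT aD CaT].
  by move=> D D'; rewrite !inE => /eqP -> /eqP ->; apply: connect0.
have sub : T' \subset C |: T' by apply: subsetUr.
have aC : a \in C by have := set11 a; rewrite -CaT inE => /andP [].
have CD : connect (share (C |: T')) C D.
  by apply: connect1; rewrite /share !inE eqxx DT orbT; apply/existsP; exists a; rewrite aC.
have toD X : X \in C |: T' -> connect (share (C |: T')) X D.
  rewrite !inE => /orP [/eqP -> //|XT].
  by apply: (share_mono sub); apply: conn.
move=> X Y XT YT; apply: (connect_trans (toD X XT)).
by rewrite (sym_connect_sym (@share_sym _)); apply: toD.
Qed.

Lemma dual_no_long_cycle_share (l : seq {set Q1}) : uniq l -> 2 < size l ->
  {subset l <= chordless_cycles Q} ->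
  (forall C, C \in l -> exists2 a, a \in C & a \in next l C) -> False.
Proof.
move=> ul sl lC ex; have [C Cl] : exists C, C \in l.
  by case: l sl {ul lC ex} => // C l _; exists C; apply: mem_head.
have [a0 _ _] := ex C Cl.
apply: (dual_no_long_cycle treeG (e := fun C =>
  odflt a0 [pick a | (a \in C) && (a \in next l C)]) ul sl lC) => D Dl.
case: pickP => [a /andP [] //|none].
by have [a aD an] := ex D Dl; have := none a; rewrite aD an.
Qed.

(** If C met the cycles glued so far in a second arrow b, a path joining the two cycles
    of T through a and b could be closed by C to a cycle of the dual tree. *)
Lemma grow_meet T C D a : grown T -> C \in chordless_cycles Q -> C \notin T ->
  D \in T -> a \in C -> a \in D -> C :&: cover T = [set a].
Proof.
move=> gT CC CT DT aC aD; have /subsetP sub := grown_sub gT.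
have neC X : X \in T -> C != X by move=> XT; apply: contraNneq CT => ->.
apply/setP => b; rewrite !inE; apply/andP/eqP => [[bC /bigcupP [D' D'T bD']]|->]; last first.
  by split=> //; apply/bigcupP; exists D.
have [DD'|DD'] := eqVneq D D'.
  by rewrite -DD' in bD'; apply: (dual_share_one treeG CC (sub D DT) (neC D DT)).
exfalso; have /connectP [p pth lastE] := grown_connected gT DT D'T.
case/shortenP: pth lastE => {}p pth up _ lastE.
have pT : {subset D :: p <= T}.
  move=> X; rewrite inE => /orP [/eqP -> //|].
  elim: p D {DT aD DD' up lastE} pth => //= Y p IH D /andP [/and3P [_ YT _] pth].
  by rewrite inE => /orP [/eqP ->|/(IH Y pth)].
have Cp : C \notin D :: p by apply: contra CT; apply: pT.
have ul : uniq [:: C, D & p] by rewrite cons_uniq Cp.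
apply: (dual_no_long_cycle_share ul).
- by case: p lastE {pth up pT Cp ul} => //= e; rewrite e eqxx in DD'.
- by move=> X; rewrite inE => /orP [/eqP -> //|/pT/sub].
move=> X Xl; rewrite next_nth Xl.
move: Xl; rewrite inE => /orP [/eqP ->|Xp]; first by exists a => //=; rewrite eqxx.
have XC : (C == X) = false by apply/negbTE/neC/pT.
have -> : index X [:: C, D & p] = (index X (D :: p)).+1 by rewrite /= XC.
rewrite [nth _ _ _]/=.
have := Xp; rewrite -index_mem /= ltnS leq_eqVlt => /orP [/eqP e|lt].
  (* X is the last cycle of the chain, and the default value of nth is its successor C. *)
exists b; last by rewrite [X in nth _ _ X]e nth_default.
  have -> : X = D' by rewrite -(nth_index C Xp) /= e lastE (last_nth C).
  by [].
have /and3P [_ _ /existsP [c /andP [c1 c2]]] := pathP C pth _ lt.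
by exists c => //; rewrite -(nth_index C Xp).
Qed.

(** The dual graph is connected, and a boundary arrow is adjacent there only to the cycle
    containing it, so some edge between two cycles leaves T. *)
Lemma grow_step T : grown T -> T != chordless_cycles Q ->
  exists C D a, [/\ C \in chordless_cycles Q, C \notin T, D \in T, a \in C & a \in D].
Proof.
move=> gT neT; have /subsetP sub := grown_sub gT.
have [C0 C0T] : exists C, C \in T.
  by elim: gT => [C _|T' C *]; exists C; rewrite !inE eqxx.
have [C CC CT] : exists2 C, C \in chordless_cycles Q & C \notin T.
  apply/subsetPn; apply: contraNN neT => sub'.
  by rewrite eqEsubset sub' grown_sub.
apply: contrapT => none.
have closedT D C' a : D \in T -> C' \in chordless_cycles Q -> a \in D -> a \in C' -> C' \in T.
  move=> DT C'C aD aC'; apply: contraT => C'T; case: none.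
  by exists C', D, a.
pose X (v : ({set Q1} + Q1)%type) :=
  match v with inl D => D \in T | inr a => [exists D in T, a \in D] end.
have adjX v w : madj G v w -> X v -> X w.
  case/and3P => vG wG /existsP [[a E] /andP [eG /eqP /= vwE]]; rewrite {E}vwE in eG.
  move: eG; rewrite inE => /existsP [D /andP [] /=].
  rewrite mem_cycles_through => /andP [DC aD] /orP [].
    case/existsP => D' /andP []; rewrite mem_cycles_through => /andP [D'C aD'].
    case/andP => _ /eqP e.
    have : v \in [set inl D; inl D'] by rewrite -e !inE eqxx.
    have : w \in [set inl D; inl D'] by rewrite -e !inE eqxx orbT.
    rewrite !inE => /orP [] /eqP -> /orP [] /eqP -> //= h.
      exact: (closedT D' D a).
    exact: (closedT D D' a).
  case/andP => _ /eqP e.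
  have : v \in [set inl D; inr a] by rewrite -e !inE eqxx.
  have : w \in [set inl D; inr a] by rewrite -e !inE eqxx orbT.
  rewrite !inE => /orP [] /eqP -> /orP [] /eqP -> //=.
    by move=> /existsP [D' /andP [D'T aD']]; apply: (closedT D' D a).
  by move=> DT; apply/existsP; exists D; rewrite DT.
have [[_ conn] _] := treeG.
have /connectP [p pth e] := conn (inl C0) (inl C) (dual_vertex (sub _ C0T)) (dual_vertex CC).
have : X (last (inl C0) p).
  elim: p (inl C0 : ({set Q1} + Q1)%type) (C0T : X (inl C0)) pth {e} => //= v p IH u Xu.
  by case/andP => /adjX/(_ Xu) Xv; apply: IH.
by rewrite -e /= (negbTE CT).
Qed.

Lemma grown_all T : grown T -> grown (chordless_cycles Q).
Proof.
have [n] := ubnP (#|chordless_cycles Q| - #|T|)%N; elim: n T => // n IH T lt gT.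
have [<- //|neT] := eqVneq T (chordless_cycles Q).
have [C [D [a [CC CT DT aC aD]]]] := grow_step gT neT.
have gCT := grownU gT CC CT DT aD (grow_meet gT CC CT DT aC aD).
apply: IH gCT; rewrite cardsU1 CT /= add1n.
have : T \proper chordless_cycles Q by rewrite properEneq neT grown_sub.
move=> /proper_card ltT.
by rewrite -ltnS (leq_trans _ lt) // ltnS subnS prednK ?subn_gt0.
Qed.

End Growth.

(** * Counting vertices, and finiteness of the products of arrows *)

Section Counting.
Local Open Scope nat_scope.
Variable Q : quiver.
Local Notation Q1 := (arrow Q).
Hypothesis loopless : no_loops Q.
Implicit Types (C D : {set Q1}) (a b : Q1) (T : {set {set Q1}}).

Definition vertices_of (S : {set Q1}) : {set vertex Q} := [set src a | a in S].

Lemma card_vertices_of C : C \in chordless_cycles Q -> #|vertices_of C| = #|C|.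
Proof.
move=> CC; apply: card_in_imset => a b; have cC := cycle_wordP CC.
rewrite !(cycle_list_mem cC); exact: (uniq_map_inj_in (cycle_list_uniq cC)).
Qed.

Lemma tgt_vertices_of C a : C \in chordless_cycles Q -> a \in C -> tgt a \in vertices_of C.
Proof.
move=> CC aC; have cC := cycle_wordP CC.
have : tgt a \in map (@tgt Q) (cycle_word C) by apply: map_f; rewrite -(cycle_list_mem cC).
rewrite (cycle_list_tgt cC) mem_rot => /mapP [b bC ->].
by apply: imset_f; rewrite (cycle_list_mem cC).
Qed.

Lemma src_vertices_of (S : {set Q1}) a : a \in S -> src a \in vertices_of S.
Proof. exact: imset_f. Qed.

Lemma vertices_ofU (S S' : {set Q1}) : vertices_of (S :|: S') = vertices_of S :|: vertices_of S'.
Proof. exact: imsetU. Qed.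

Lemma vertices_ofS (S S' : {set Q1}) : S \subset S' -> vertices_of S \subset vertices_of S'.
Proof. exact: imsetS. Qed.

Lemma tgt_vertices_cover T a : T \subset chordless_cycles Q -> a \in cover T ->
  tgt a \in vertices_of (cover T).
Proof.
move=> /subsetP sub /bigcupP [D DT aD].
apply: (subsetP (vertices_ofS (bigcup_sup D DT))).
by apply: tgt_vertices_of => //; apply: sub.
Qed.

Definition ends a : {set vertex Q} := [set src a; tgt a].

Lemma card_ends a : #|ends a| = 2.
Proof. by rewrite cards2 loopless. Qed.

Lemma cover_setU1 C T : cover (C |: T) = C :|: cover T.
Proof. by rewrite /cover bigcup_setU big_set1. Qed.

Lemma grown_ends T C D a : grown T -> C \in chordless_cycles Q -> D \in T ->
  a \in D -> C :&: cover T = [set a] ->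
  ends a \subset vertices_of C :&: vertices_of (cover T).
Proof.
move=> gT CC DT aD CaT.
have /[!inE]/andP [aC aT] : a \in C :&: cover T by rewrite CaT set11.
apply/subsetP => v; rewrite !inE => /orP [] /eqP ->.
  by rewrite !src_vertices_of.
by rewrite tgt_vertices_of // tgt_vertices_cover // grown_sub.
Qed.

Lemma sum_setU1 C T : C \notin T ->
  \sum_(X in C |: T) #|X| = #|C| + \sum_(X in T) #|X|.
Proof. exact: big_setU1. Qed.

(** A glued cycle shares with the earlier ones the two ends of an arrow, at least. *)
Lemma grown_vertices_le T : grown T ->
  #|vertices_of (cover T)| + 2 * #|T| <= \sum_(C in T) #|C| + 2.
Proof.
elim=> [C CC|T' C D a gT IH CC CT DT aD CaT].
  by rewrite /cover !big_set1 card_vertices_of // cards1.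
have := subset_leq_card (grown_ends gT CC DT aD CaT); rewrite card_ends.
have := cardsUI (vertices_of C) (vertices_of (cover T')).
rewrite cover_setU1 vertices_ofU sum_setU1 // cardsU1 CT (card_vertices_of CC).
lia.
Qed.

(** Equality in [grown_vertices_le] passes to the earlier steps, and forces a glued cycle to
    have no other vertex in common with the earlier ones. *)
Lemma grown_vertices_eq T C D a : grown T -> C \in chordless_cycles Q -> C \notin T ->
  D \in T -> a \in D -> C :&: cover T = [set a] ->
  \sum_(X in C |: T) #|X| + 2 <= #|vertices_of (cover (C |: T))| + 2 * #|C |: T| ->
  \sum_(X in T) #|X| + 2 <= #|vertices_of (cover T)| + 2 * #|T| /\
  vertices_of C :&: vertices_of (cover T) = ends a.
Proof.
move=> gT CC CT DT aD CaT.
have ge2 := subset_leq_card (grown_ends gT CC DT aD CaT); rewrite card_ends in ge2.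
have := cardsUI (vertices_of C) (vertices_of (cover T)).
have := grown_vertices_le gT.
rewrite cover_setU1 vertices_ofU sum_setU1 // cardsU1 CT (card_vertices_of CC) => le un ge.
have arith (U I c v S t : nat) : 1 < I -> v + 2 * t <= S + 2 -> U + I = c + v ->
    c + S + 2 <= U + 2 * (1 + t) -> S + 2 <= v + 2 * t /\ I <= 2 by lia.
have [ge' I2] := arith _ _ _ _ _ _ ge2 le un ge; split=> //.
by apply/esym/eqP; rewrite eqEcard (grown_ends gT CC DT aD CaT) card_ends.
Qed.

(** The boundary arrows of the part of the quiver formed by the cycles in T. *)
Definition arrows_in_one T : {set Q1} :=
  [set a in cover T | #|[set C in T | a \in C]| == 1].

Lemma mem_arrows_in_one T a :
  (a \in arrows_in_one T) = (a \in cover T) && (#|[set C in T | a \in C]| == 1).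
Proof. by rewrite inE. Qed.

(** Gluing a cycle along a turns at most a into an interior arrow, and the other arrows
    of the cycle are new boundary arrows. *)
Lemma grown_boundary_ge T : grown T ->
  \sum_(C in T) #|C| + 2 <= #|arrows_in_one T| + 2 * #|T|.
Proof.
elim=> [C CC|T' C D a gT IH CC CT DT aD CaT].
  rewrite big_set1 cards1 muln1 leq_add2r subset_leq_card //.
  apply/subsetP => a aC; rewrite inE /cover big_set1 aC /=.
  rewrite (_ : [set _ in _ | _] = [set C]) ?cards1 //.
  by apply/setP => X; rewrite !inE; case: eqP => // ->.
have /[!inE]/andP [aC aT] : a \in C :&: cover T' by rewrite CaT set11.
have meet b : b \in C -> b \in cover T' -> b = a.
  by move=> bC bT; apply/set1P; rewrite -CaT inE bC.
have sub : (arrows_in_one T' :\ a) :|: (C :\ a) \subset arrows_in_one (C |: T').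
  apply/subsetP => b; rewrite in_setU !in_setD1 !mem_arrows_in_one cover_setU1 in_setU.
  case/orP => /andP [ba].
    case/andP => bT one; rewrite bT orbT /=.
    rewrite (_ : [set _ in _ | _] = [set X in T' | b \in X]) //.
    apply/setP => X; rewrite !inE; have [->|//] := eqVneq X C.
    rewrite (negbTE CT) /=; apply/negP => bC.
    by rewrite (meet b bC bT) eqxx in ba.
  move=> bC; rewrite bC /=.
  rewrite (_ : [set _ in _ | _] = [set C]) ?cards1 //.
  apply/setP => X; rewrite !inE; have [->|_] := eqVneq X C; first by rewrite bC.
  apply/negP => /= /andP [XT bX]; have bT : b \in cover T' by apply/bigcupP; exists X.
  by rewrite (meet b bC bT) eqxx in ba.
have disj : [disjoint arrows_in_one T' :\ a & C :\ a].
  rewrite disjoint_subset; apply/subsetP => b; rewrite in_setD1 mem_arrows_in_one.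
  case/andP => ba /andP [bT _]; rewrite inE in_setD1.
  by rewrite ba /=; apply/negP => bC; rewrite (meet b bC bT) eqxx in ba.
have := subset_leq_card sub; rewrite cardsU disjoint_setI0 // cards0 subn0.
rewrite sum_setU1 // cardsU1 CT /=.
have := cardsD1 a C; rewrite aC; have := cardsD1 a (arrows_in_one T').
have arith (d : bool) (b1 c1 b c u S t : nat) : b = d + b1 -> c = 1 + c1 -> b1 + c1 <= u ->
  S + 2 <= b + 2 * t -> c + S + 2 <= u + 2 * (1 + t) by case: d; lia.
by move=> bE cE le; apply: arith bE cE le IH.
Qed.

(** A simple cycle has as many vertices as edges. *)
Lemma boundary_cycle_le (c : seq (vertex Q * Q1)) :
  (forall a : Q1, exists2 C, C \in chordless_cycles Q & a \in C) ->
  simple_mcycle (underlying_graph Q) c -> [set a in map snd c] = boundary_arrows Q ->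
  #|boundary_arrows Q| <= #|vertices_of (cover (chordless_cycles Q))|.
Proof.
move=> allC /and5P [_ u1 u2 _ cyc] <-.
have -> : #|[set a in map snd c]| = #|[set v in map fst c]|.
  by rewrite !cardsE !(card_uniqP _) // !size_map.
apply/subset_leq_card/subsetP => v; rewrite inE => /mapP [p pc ->] {v}.
have := next_cycle cyc pc; rewrite /= => /eqP e.
have : p.1 \in ends p.2 by rewrite /ends e !inE eqxx.
have cov : p.2 \in cover (chordless_cycles Q).
  by have [C CC pC] := allC p.2; apply/bigcupP; exists C.
rewrite !inE => /orP [] /eqP ->; first exact: src_vertices_of.
exact: tgt_vertices_cover.
Qed.

End Counting.

Section FiniteDimensional.
Variables (R : pzRingType) (Q : quiver) (x : arrow Q -> R).
Local Notation Q1 := (arrow Q).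
Local Notation W := (word_val x).
Hypothesis x_comp : forall a b, tgt a != src b -> x a * x b = 0.
Hypothesis loopless : no_loops Q.
Implicit Types (C D : {set Q1}) (a b : Q1) (T : {set {set Q1}}).

(** The relations that pass on to smaller sets T.  At a boundary arrow a of the whole
    quiver, the Jacobian relation says that the path closing a vanishes; for an arrow that
    becomes a boundary arrow on removing cycles, only the vanishing of the two closed
    words at a remains. *)
Definition cycle_relations T : Prop :=
  (forall C D a, C \in T -> D \in T -> C != D -> a \in C -> a \in D ->
     W (co_path C a) = W (co_path D a) \/ W (co_path C a) = - W (co_path D a)) /\
  (forall C a, C \in T -> a \in C -> (forall D, D \in T -> a \in D -> D = C) ->
     W (a :: co_path C a) = 0 /\ W (rcons (co_path C a) a) = 0).

Lemma co_path_cons C a : C \in chordless_cycles Q -> a \in C ->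
  exists b r, co_path C a = b :: r.
Proof.
move=> CC aC; have [_] := cycle_list_path (co_pathP CC aC).
case: (co_path C a) => [/= e|b r _]; last by exists b, r.
by have := loopless a; rewrite e eqxx.
Qed.

(** The path that closes a can be merged into a single letter when its inner vertices,
    those of C other than the ends of a, are not on the arrows in S. *)
Lemma finite_products_ear C a (S : seq Q1) : C \in chordless_cycles Q -> a \in C ->
  (forall v c, v \in vertices_of C -> v \notin ends a -> c \in S -> src c != v /\ tgt c != v) ->
  finite_products (W (co_path C a) :: map x S) ->
  finite_products (map x (co_path C a) ++ map x S).
Proof.
move=> CC aC newS; have cC := co_pathP CC aC.
have [b [r bE]] := co_path_cons CC aC; rewrite bE in cC *.
have [/= /andP [/eqP ab pr] _] := cycle_list_path cC.
have := cycle_list_uniq cC => /= /and3P [].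
rewrite inE negb_or => /andP [_ ar] br ur.
have := cycle_list_tgt_uniq cC => /= /andP [at_ ut] FP.
have := @finite_products_contract R Q x x_comp loopless S (src b) [::] b r pr ur ut erefl.
rewrite /= {2}/word_val big_seq1; apply=> //.
  by move=> c cr; apply: contraNneq at_; rewrite ab => <-; exact: (map_f (@tgt Q) cr).
move=> y c yr cS; apply: newS => //.
  by apply: src_vertices_of; rewrite (cycle_list_mem cC) !inE yr !orbT.
rewrite !inE negb_or ab; apply/andP; split.
  by apply: contraNneq ar => <-; apply: map_f.
by apply: contraNneq br => <-; apply: map_f.
Qed.

Lemma word_val_neg s t u v : W s = W t \/ W s = - W t ->
  W (u ++ s ++ v) = 0 -> W (u ++ t ++ v) = 0.
Proof.
rewrite !word_val_cat => -[->//|->]; rewrite mulNr mulrN => /eqP.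
by rewrite oppr_eq0 => /eqP.
Qed.

(** Induction along the gluing.  A newly glued cycle C, attached along a, is the only one
    through its other arrows; the vanishing of the closed words at the two neighbours of a
    in C yields the vanishing of those at a, whence the relations for the earlier cycles.
    The path of C closing a is inner apart from its ends, and equals up to sign a path of
    the earlier cycles. *)
Lemma grown_finite_products T : grown T ->
  (\sum_(C in T) #|C| + 2 <= #|vertices_of (cover T)| + 2 * #|T|)%N ->
  cycle_relations T -> finite_products (map x (enum (cover T))).
Proof.
elim=> [C CC|T' C D a gT IH CC CT DT aD CaT].
  move=> _ [_ R2]; have cC := cycle_wordP CC.
  have [a aC] : exists a, a \in C.
    case: (cycle_word C) cC => [[]//|a s] cC.
    by exists a; rewrite (cycle_list_mem cC) mem_head.
  have [ab ba] : W (a :: co_path C a) = 0 /\ W (rcons (co_path C a) a) = 0.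
    by apply: R2; rewrite ?set11 // => D /set1P.
  have [b [r bE]] := co_path_cons CC aC.
  have [/= pb lb] := cycle_list_path (co_pathP CC aC).
  have := @finite_products_ear C a [:: a] CC aC.
  move=> FP; apply: finite_products_sub (FP _ _).
  - move=> _ /mapP [c + ->]; rewrite mem_enum /cover big_set1.
    rewrite (cycle_list_mem (co_pathP CC aC)) inE => /orP [/eqP ->|cb].
      by rewrite mem_cat mem_head orbT.
    by rewrite mem_cat map_f.
  - move=> v c _ + /[!inE] /eqP ->; rewrite !inE negb_or ![v == _]eq_sym => /andP [-> ->].
    by [].
  - rewrite word_val_cons in ab; rewrite word_val_rcons in ba.
    apply: finite_products_nilpotent => //; last by apply: x_comp; rewrite eq_sym loopless.
    rewrite bE in pb lb *; rewrite {2}word_val_cons.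
    have /andP [/eqP tb _] := pb.
    have -> : W (b :: r) = W (belast b r) * x (last b r).
      by rewrite lastI word_val_rcons.
    rewrite -mulrA [x _ * _]mulrA x_comp ?mul0r ?mulr0 //.
    by rewrite lb -tb loopless.
move=> ge [R1 R2].
have [ge' meet] := grown_vertices_eq loopless gT CC CT DT aD CaT ge.
have /[!inE]/andP [aC aT] : a \in C :&: cover T' by rewrite CaT set11.
have CinU : C \in C |: T' by rewrite setU11.
have inU X : X \in T' -> X \in C |: T' by move=> XT; rewrite inE XT orbT.
have neC X : X \in T' -> C != X by move=> XT; apply: contraNneq CT => ->.
have cC := co_pathP CC aC.
have only b : b \in co_path C a -> forall X, X \in C |: T' -> b \in X -> X = C.
  move=> bC X; rewrite in_setU1 => /orP [/eqP -> //|XT bX].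
  have : b \in C :&: cover T'.
    by rewrite inE (cycle_list_mem cC) inE bC orbT; apply/bigcupP; exists X.
  rewrite CaT inE => /eqP ba; have := map_uniq (cycle_list_uniq cC).
  by rewrite cons_uniq -{1}ba bC.
(* These words are closed words at the last and the first arrow of the path closing a. *)
have zero : W (a :: co_path C a) = 0 /\ W (rcons (co_path C a) a) = 0.
  have [b [r bE]] := co_path_cons CC aC.
  split.
    have [r' [z zE]] : exists r' z, co_path C a = rcons r' z.
      by rewrite bE lastI; eexists; eexists; reflexivity.
    have cz := cC; rewrite zE in cz; have cz' := cycle_list_rotr cz.
    have [||_] := R2 C z CinU.
    - by rewrite (cycle_list_mem cC) zE inE mem_rcons mem_head orbT.
    - by apply: only; rewrite zE mem_rcons mem_head.
    - by rewrite (co_path_eq CC cz') zE.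
  have cb := cC; rewrite bE in cb; have cb' := cycle_list_rotl cb.
  have [||+ _] := R2 C b CinU.
  - by rewrite (cycle_list_mem cC) bE !inE eqxx orbT.
  - by apply: only; rewrite bE mem_head.
  - by rewrite (co_path_eq CC cb') bE.
have relT : cycle_relations T'.
  split=> [X Y b XT YT|X b XT bX uniqX]; first by apply: R1; apply: inU.
  have [bC|bC] := boolP (b \in C); last first.
    apply: R2 => //; first exact: inU.
    by move=> Y; rewrite in_setU1 => /orP [/eqP ->|/uniqX//]; rewrite (negbTE bC).
  have ba : b = a.
    by apply/set1P; rewrite -CaT inE bC; apply/bigcupP; exists X.
  rewrite ba in bX *; have sg := R1 C X a CinU (inU X XT) (neC X XT) aC bX.
  have [z1 z2] := zero; split.
    have := word_val_neg (u := [:: a]) (v := [::]) sg; rewrite !cats0; exact.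
  have := word_val_neg (u := [::]) (v := [:: a]) sg; rewrite /= !cats1; exact.
have FP := IH ge' relT.
have CD := neC D DT.
have FPb : finite_products (W (co_path C a) :: map x (enum (cover T'))).
  apply: (finite_products_signed_word (s := map x (co_path D a))) FP.
    move=> _ /mapP [c cD ->]; apply: map_f; rewrite mem_enum; apply/bigcupP; exists D => //.
    have /subsetP sub := grown_sub gT.
    by rewrite (cycle_list_mem (co_pathP (sub D DT) aD)) inE cD orbT.
  rewrite big_map; exact: (R1 C D a CinU (inU D DT) CD aC aD).
have {}FPb := finite_products_ear CC aC _ FPb.
apply: finite_products_sub (FPb _).
  move=> _ /mapP [c + ->]; rewrite mem_enum cover_setU1 inE => /orP [cC'|cT].
    move: cC'; rewrite (cycle_list_mem cC) inE => /orP [/eqP ->|cb].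
      by rewrite mem_cat [X in _ || X]map_f ?orbT // mem_enum.
    by rewrite mem_cat map_f.
  by rewrite mem_cat [X in _ || X]map_f ?orbT // mem_enum.
move=> v c vC va; rewrite mem_enum => cT; split; apply: contraNneq va => e; rewrite -meet inE vC -e.
  exact: src_vertices_of.
by apply: tgt_vertices_cover => //; apply: grown_sub gT.
Qed.

End FiniteDimensional.

(** * Dimer tree algebras are finite-dimensional *)

(** The coefficients are a row vector, so that endomorphisms of V can be described by
    matrices although the spanning family need not be free. *)
Definition finite_span (k : comNzRingType) (V : lmodType k) : Prop :=
  exists n (e : 'I_n -> V), forall v, exists c : 'rV[k]_n, v = \sum_i c 0 i *: e i.

Lemma finite_span_finType (k : comNzRingType) (V : lmodType k) (T : finType) (e : T -> V) :
  (forall v, exists c : T -> k, v = \sum_t c t *: e t) -> finite_span V.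
Proof.
move=> eP; exists #|T|, (fun i => e (enum_val i)) => v.
have [c ->] := eP v; exists (\row_i c (enum_val i)).
rewrite (reindex (@enum_val T T)) /=; last exact/onW_bij/enum_val_bij.
by apply: eq_bigr => i _; rewrite mxE.
Qed.


Section FiniteSpan.
Variables (k : fieldType) (Q : quiver).
Local Notation Q1 := (arrow Q).
Hypothesis dimerQ : dimer_tree_quiver Q.
Variables (C0 : {set Q1}) (A : algType k) (pi : {rmorphism path_algebra k Q -> A}).
Hypothesis jac : is_jacobian_algebra (potential k C0) pi.
Local Notation x := (fun a : Q1 => pi (qarrow k a)).
Local Notation W := (word_val x).

(** Three cycles through one arrow would form a triangle in the dual tree. *)
Lemma two_cycles_through (C D : {set Q1}) a : C \in chordless_cycles Q ->
  D \in chordless_cycles Q -> C != D -> a \in C -> a \in D ->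
  cycles_through a = [set C; D].
Proof.
move=> CC DD CD aC aD; have [_ _ _ treeG _] := dimerQ.
apply/setP => E; rewrite mem_cycles_through in_set2.
apply/andP/idP => [[EE aE]|/orP [] /eqP ->] //.
apply: contraT; rewrite negb_or => /andP [EC ED].
exfalso; apply: (dual_no_long_cycle treeG (l := [:: C; D; E]) (e := fun=> a)) => //.
- by rewrite /= !inE negb_or CD eq_sym EC eq_sym ED.
- by move=> X; rewrite 2!in_cons mem_seq1 => /or3P [] /eqP ->.
have all X : X \in [:: C; D; E] -> a \in X by rewrite !inE => /or3P [] /eqP ->.
by move=> X Xl; split; apply: all => //; rewrite mem_next.
Qed.

Lemma jacobian_cycle_relations : cycle_relations x (chordless_cycles Q).
Proof.
have [_ [nl _] _ _ _] := dimerQ; have rel := jacobian_relation jac nl.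
split=> [C D a CC DD CD aC aD|C a CC aC uniqC].
  have := rel a; rewrite (two_cycles_through CC DD CD aC aD).
  rewrite big_setU1 ?inE //= big_set1 => /eqP; rewrite addr_eq0 => /eqP.
  move: (mdist _ _ _) (mdist _ _ _) => m n.
  rewrite -scalerN -[(-1) ^+ m]signr_odd -[(-1) ^+ n]signr_odd.
  case: (odd m) (odd n) => -[]; rewrite !(expr0, expr1) ?scale1r ?scaleN1r ?opprK => e.
  - by right; rewrite -e opprK.
  - by left.
  - by left; apply: oppr_inj.
  - by right.
have : W (co_path C a) = 0.
  have := rel a; rewrite (_ : cycles_through a = [set C]).
    rewrite big_set1 => /eqP; rewrite scaler_eq0 signr_eq0 /=.
    by move/eqP.
  apply/setP => D; rewrite mem_cycles_through in_set1; apply/andP/eqP => [[DD aD]|->//].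
  exact: uniqC.
by rewrite word_val_cons word_val_rcons => ->; rewrite mulr0 mul0r.
Qed.

Lemma finite_products_arrows : finite_products (map x (enum Q1)).
Proof.
have [_ [nl _] allC treeG [c cyc cE]] := dimerQ.
have [C CC] : exists C, C \in chordless_cycles Q.
  have [[ne _] _] := treeG; have [[C|a]] := set0Pn _ ne; rewrite inE => h.
    by exists C.
  by have [C CC _] := allC a; exists C.
have gr := grown_all treeG (grown1 CC).
apply: (@finite_products_sub _ (map x (enum (cover (chordless_cycles Q))))).
  move=> _ /mapP [a _ ->]; apply: map_f; rewrite mem_enum.
  by have [D DD aD] := allC a; apply/bigcupP; exists D.
apply: (grown_finite_products (@qarrow_comp k Q A pi) nl gr _ jacobian_cycle_relations).
apply: leq_trans (grown_boundary_ge gr) _; rewrite leq_add2r.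
apply: leq_trans (boundary_cycle_le allC cyc cE).
apply/subset_leq_card/subsetP => a; rewrite mem_arrows_in_one => /andP [_ one].
by rewrite inE.
Qed.

Lemma jacobian_finite_span : finite_span A.
Proof.
have [X XP] := finite_products_arrows; have [piZ pi_surj _] := jac.
pose e (t : vertex Q * 'I_(size X)) : A := pi (qidem k t.1) * X`_t.2.
apply: (@finite_span_finType k A _ e) => y; have [f <-] := pi_surj y.
elim/path_algebra_ind: f => [|c f g [cf cfE] [cg cgE]|p].
- by exists (fun=> 0); rewrite rmorph0 big1 // => t _; rewrite scale0r.
- exists (fun t => c * cf t + cg t); rewrite rmorphD piZ cfE cgE scaler_sumr -big_split /=.
  by apply: eq_bigr => t _; rewrite scalerDl scalerA.
rewrite -qword_path pi_qword ?qpathP //.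
have : W (qarrows p) \in X.
  rewrite /word_val -(big_map x xpredT id); apply: XP => _ /mapP [a _ ->].
  by apply: map_f; rewrite mem_enum.
move=> WX; have lt := WX; rewrite -index_mem in lt.
exists (fun t => (t == (qstart p, Ordinal lt))%:R).
rewrite (bigD1 (qstart p, Ordinal lt)) //= eqxx scale1r big1 ?addr0; last first.
  by move=> t /negbTE ->; rewrite scale0r.
by rewrite /e /= nth_index.
Qed.

End FiniteSpan.

(** * Dual bases of finitely generated projective modules *)

Definition mk_linear (R : pzRingType) (U V : lmodType R) (f : U -> V)
  (lf : linear f) : {linear U -> V} := HB.pack f (GRing.isLinear.Build R U V _ f lf).

Lemma mk_linearE (R : pzRingType) (U V : lmodType R) (f : U -> V) (lf : linear f) x :
  mk_linear lf x = f x.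
Proof. by []. Qed.

Section DualBasis.
Variable R : pzRingType.
Implicit Types P X Y : lmodType R.

Definition dual_basis P n (g : 'I_n -> P) (xi : 'I_n -> {linear P -> R^o}) : Prop :=
  forall x, x = \sum_i (xi i x : R) *: g i.

Lemma linear_combination_linear P n (xi : 'I_n -> {linear P -> R^o}) Y (z : 'I_n -> Y) :
  linear (fun x : P => \sum_i (xi i x : R) *: z i).
Proof.
move=> c x y; rewrite scaler_sumr -big_split /=; apply: eq_bigr => i _.
by rewrite linearP scalerDl scalerA.
Qed.

Lemma dual_basis_linear P n (g : 'I_n -> P) xi Y (h : {linear P -> Y}) x :
  dual_basis g xi -> h x = \sum_i (xi i x : R) *: h (g i).
Proof.
move=> db; rewrite {1}(db x) linear_sum; apply: eq_bigr => i _.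
by rewrite linearZ.
Qed.

Lemma dual_basis_fg P n (g : 'I_n -> P) xi : dual_basis g xi -> finitely_generated P.
Proof. by move=> db; exists n, g => m; exists (fun i => xi i m). Qed.

(** The coordinates of a section of the projection of a free module onto P. *)
Lemma projective_dual_basis P : finitely_generated P -> projective P ->
  exists n (g : 'I_n -> P) xi, dual_basis g xi.
Proof.
move=> [n [g gP]] prP; exists n, g.
have comb : linear (fun v : 'rV[R]_n => \sum_i v 0 i *: g i).
  move=> c u v; rewrite scaler_sumr -big_split /=; apply: eq_bigr => i _.
  by rewrite !mxE scalerDl scalerA.
have coef i : linear (fun v : 'rV[R]_n => v 0 i : R^o).
  by move=> c u v; rewrite !mxE.
have [|l lP] := prP _ _ (mk_linear comb) (mk_linear (fun c (x y : P) => erefl (c *: x + y))).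
  move=> y; have [c ->] := gP y; exists (\row_i c i).
  by rewrite mk_linearE; apply: eq_bigr => i _; rewrite mxE.
have coefl i : linear (fun x => l x 0 i : R^o).
  by move=> c x y; rewrite linearP !mxE.
exists (fun i => mk_linear (coefl i)) => x.
by have := lP x; rewrite !mk_linearE => ->.
Qed.

Lemma dual_basis_projective P n (g : 'I_n -> P) xi : dual_basis g xi -> projective P.
Proof.
move=> db X Y q h sq.
have /fin_all_exists [z zP] : forall i, exists z, q z = h (g i) by move=> i; apply: sq.
exists (mk_linear (linear_combination_linear xi z)) => x; rewrite mk_linearE linear_sum.
rewrite (dual_basis_linear h x db); apply: eq_bigr => i _.
by rewrite linearZ /= zP.
Qed.

End DualBasis.

(** * Quotient modules and separating functionals *)

Section QuotientModule.
Variables (R : pzRingType) (U : lmodType R) (S : {pred U}).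
Hypothesis S_submod : submod_closed S.
Let I : zmodClosed U := HB.pack_for (zmodClosed U) S
  (GRing.isSubmodClosed.Build R U S S_submod).
Local Notation UI := (Quotient.quot I).
Local Notation piI := (\pi_UI)%qT.

Lemma quotient_pi_eq0 u : piI u = 0 <-> u \in S.
Proof.
have -> : 0 = piI 0 by rewrite raddf0.
have E : (u \in I) = (piI u == piI 0).
  by rewrite -(Quotient.idealrBE I) subr0.
by split=> [/eqP|uS]; [rewrite -E|apply/eqP; rewrite -E].
Qed.

Definition quotient_scale (c : R) (x : UI) : UI := piI (c *: generic_quotient.repr x).

Lemma quotient_scale_pi c u : quotient_scale c (piI u) = piI (c *: u).
Proof.
apply/eqP; rewrite -subr_eq0 -raddfB -scalerBr; apply/eqP/quotient_pi_eq0.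
have [S0 SP] := S_submod; have SZ : forall v, v \in S -> c *: v \in S.
  by move=> v vS; rewrite -[c *: v]addr0; apply: SP.
by apply/SZ/quotient_pi_eq0; rewrite raddfB /= generic_quotient.reprK subrr.
Qed.

Lemma quotient_piP (x : UI) : exists u, x = piI u.
Proof. by exists (generic_quotient.repr x); rewrite generic_quotient.reprK. Qed.

Fact quotient_scaleA a b x : quotient_scale a (quotient_scale b x) = quotient_scale (a * b) x.
Proof. by have [u ->] := quotient_piP x; rewrite !quotient_scale_pi scalerA. Qed.
Fact quotient_scale1 : left_id 1 quotient_scale.
Proof. by move=> x; have [u ->] := quotient_piP x; rewrite quotient_scale_pi scale1r. Qed.
Fact quotient_scaleDr : right_distributive quotient_scale +%R.
Proof.
move=> a x y; have [u ->] := quotient_piP x; have [v ->] := quotient_piP y.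
by rewrite -raddfD !quotient_scale_pi -raddfD scalerDr.
Qed.
Fact quotient_scaleDl x : {morph quotient_scale^~ x : a b / a + b}.
Proof.
move=> a b; have [u ->] := quotient_piP x.
by rewrite !quotient_scale_pi -raddfD scalerDl.
Qed.

(** Provides the cokernels that define transposes. *)
Lemma quotient_module : exists (N : lmodType R) (q : {linear U -> N}),
  surjective_map q /\ forall u, q u = 0 <-> u \in S.
Proof.
pose m := GRing.Zmodule_isLmodule.Build R UI
  quotient_scaleA quotient_scale1 quotient_scaleDr quotient_scaleDl.
pose N : lmodType R := HB.pack UI m.
have q_linear : linear (fun u => piI u : N).
  by move=> c u v; rewrite raddfD /= -[in LHS]quotient_scale_pi.
exists N, (mk_linear q_linear); split; last exact: quotient_pi_eq0.
by move=> x; have [u ->] := quotient_piP x; exists u.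
Qed.

End QuotientModule.

Section SeparatingFunctional.
Import classical_sets.
Variables (k : fieldType) (V : lmodType k) (S : set V).
Hypothesis S0 : S 0.
Hypothesis SP : forall c u v, S u -> S v -> S (c *: u + v).

Let subspace (T : set V) := forall c u v, T u -> T v -> T (c *: u + v).

(** A subspace that is maximal among those containing S and avoiding v is a hyperplane
    complementary to v, by Zorn's lemma; the functional is the coordinate along v. *)
Lemma separating_functional v : ~ S v ->
  exists f : {linear V -> k^o}, (forall u, S u -> f u = 0) /\ f v != 0.
Proof.
move=> Sv.
pose avoids (T : set V) := subspace T /\ ~ T v.
have [|T [[TP Tv] maxT]] := @Zorn_bigcup V (fun T => avoids (T `|` S)%classic).
  move=> F FP totF.
  have [F0|/set0P[T0 FT0]] := eqVneq F set0.
  - rewrite F0 bigcup_set0 set0U; split=> //.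
  have common T1 T2 : F T1 -> F T2 -> exists2 T3, F T3 & (T1 `<=` T3 /\ T2 `<=` T3)%classic.
    by move=> F1 F2; case: (totF _ _ F1 F2) => s; [exists T2 => //; split|exists T1 => //; split].
  split=> [c x y|[[T FT Tv]|//]]; last by have [_] := FP _ FT; apply; left.
  have lift z : ((\bigcup_(X in F) X) `|` S)%classic z -> exists2 T, F T & (T `|` S)%classic z.
    by case=> [[T FT Tz]|Sz]; [exists T => //; left|exists T0 => //; right].
  move=> /lift [T1 F1 x1] /lift [T2 F2 y2].
  have [T3 F3 [s1 s2]] := common _ _ F1 F2.
  have [T3P _] := FP _ F3.
  have x3 : (T3 `|` S)%classic x by case: x1 => [/s1|]; [left|right].
  have y3 : (T3 `|` S)%classic y by case: y2 => [/s2|]; [left|right].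
  by case: (T3P c x y x3 y3) => h; [left; exists T3|right].
pose U := (T `|` S)%classic.
have U0 : U 0 by right.
have UZ c u : U u -> U (c *: u) by move=> Uu; rewrite -[_ *: u]addr0; apply: TP.
have UD u w : U u -> U w -> U (u + w) by move=> ??; rewrite -[u]scale1r; apply: TP.
have UN u : U u -> U (- u) by move=> ?; rewrite -scaleN1r; apply: UZ.
(* Every w is congruent to a multiple of v modulo the maximal subspace U. *)
have coefE w : exists c, U (w - c *: v).
  have [Uw|Uw] := pselect (U w); first by exists 0; rewrite scale0r subr0.
  pose T' : set V := fun x => exists2 u, U u & exists c, x = u + c *: w.
  have TT' : (U `<=` T')%classic by move=> u Uu; exists u => //; exists 0; rewrite scale0r addr0.
  have T'U : (T' `|` S = T')%classic.
    by apply/seteqP; split=> x; [case=> // Sx; apply: TT'; right|left].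
  have /maxT : (T `<` T')%classic.
    split; first by move=> x Tx; apply: TT'; left.
    by move=> T'T; apply: Uw; left; apply: T'T; exists 0 => //; exists 1; rewrite scale1r add0r.
  rewrite T'U => nav.
  have [[u Uu [c vE]]|T'v] := pselect (T' v); last first.
    case: nav; split=> // c _ _ [u1 Uu1 [c1 ->]] [u2 Uu2 [c2 ->]].
    exists (c *: u1 + u2); first exact: TP.
    exists (c * c1 + c2).
    by rewrite scalerDr scalerDl scalerA addrACA.
  have c0 : c != 0 by apply/eqP => c0; apply: Tv; rewrite vE c0 scale0r addr0.
  exists c^-1; rewrite vE scalerDr scalerA mulVf // scale1r opprD addrCA subrr addr0.
  by apply/UN/UZ.
have [f fP] := choice coefE.
have fU c w : U (w - c *: v) -> f w = c.
  move=> h; apply/eqP; rewrite eq_sym -subr_eq0; apply: contraT => nz; case: Tv.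
  have -> : v = (c - f w)^-1 *: ((w - f w *: v) - (w - c *: v)).
    rewrite opprB [X in _ *: X]addrC addrA subrK.
    by rewrite -scalerBl scalerA mulVf // scale1r.
  by apply/UZ/UD => //; apply: UN.
have f_linear : linear (f : V -> k^o).
  move=> c x y; apply: fU.
  rewrite scalerDl opprD addrACA; apply: UD => //.
  by rewrite -scalerA -scalerBr; apply: UZ.
exists (mk_linear f_linear); rewrite !mk_linearE; split.
  by move=> u Su; rewrite mk_linearE; apply: fU; rewrite scale0r subr0; right.
suff -> : f v = 1 by rewrite oner_eq0.
by apply: fU; rewrite scale1r subrr.
Qed.

End SeparatingFunctional.

(** * Tau-rigidity as a factorisation property of presentations *)

(** The right A-module X as a vector space over k. *)
Definition scalars (k : comNzRingType) (A : algType k) (X : lmodType A^c) : Type := X.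

Section Scalars.
Variables (k : comNzRingType) (A : algType k) (X : lmodType A^c).
Local Notation Xk := (scalars X).

HB.instance Definition _ := GRing.Zmodule.on Xk.

Definition scalars_scale (c : k) (x : Xk) : Xk := ((c%:A : A) : A^c) *: (x : X).

Lemma ract_mul (a b : A) (x : X) :
  (b : A^c) *: ((a : A^c) *: x) = ((a * b : A) : A^c) *: x.
Proof. by rewrite scalerA. Qed.

Fact scalars_scaleA c d x : scalars_scale c (scalars_scale d x) = scalars_scale (c * d) x.
Proof. by rewrite /scalars_scale ract_mul -scalerAl mul1r scalerA mulrC. Qed.
Fact scalars_scale1 : left_id 1 scalars_scale.
Proof. by move=> x; rewrite /scalars_scale scale1r; apply: (@scale1r A^c X). Qed.
Fact scalars_scaleDr : right_distributive scalars_scale +%R.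
Proof. by move=> c x y; rewrite /scalars_scale scalerDr. Qed.
Fact scalars_scaleDl x : {morph scalars_scale^~ x : c d / c + d}.
Proof.
by move=> c d; rewrite /scalars_scale scalerDl; apply: (@scalerDl A^c X).
Qed.

HB.instance Definition _ := GRing.Zmodule_isLmodule.Build k Xk
  scalars_scaleA scalars_scale1 scalars_scaleDr scalars_scaleDl.

Lemma scalars_scaleE c (x : Xk) : c *: x = ((c%:A : A) : A^c) *: (x : X) :> X.
Proof. by []. Qed.

Lemma ract_scalar (a : A) c (x : X) :
  (a : A^c) *: (c *: (x : Xk) : X) = c *: ((a : A^c) *: x : Xk) :> Xk.
Proof.
rewrite !scalars_scaleE !ract_mul.
by rewrite -scalerAl mul1r -scalerAr mulr1.
Qed.

End Scalars.

Lemma linear_scalars (k : comNzRingType) (A : algType k) (X Y : lmodType A^c)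
    (f : {linear X -> Y}) c (x : X) :
  f (c *: (x : scalars X) : X) = c *: (f x : scalars Y) :> Y.
Proof. exact: linearZ. Qed.

(** Surjectivity of Hom (P0, X) -> Hom (P1, X), composition with f. *)
Definition maps_factor (R : pzRingType) (P1 P0 X : lmodType R) (f : {linear P1 -> P0}) :=
  forall g : {linear P1 -> X}, exists h : {linear P0 -> X}, forall y, g y = h (f y).

Section Criterion.
Variables (k : comNzRingType) (A : algType k).

Lemma rd_evalZ (P : lmodType A^c) (a : A) (phi : right_dual P) p :
  rd_eval (a *: phi) p = a * rd_eval phi p.
Proof. by []. Qed.

Lemma rd_eval_sum (P : lmodType A^c) I (r : seq I) (phi : I -> right_dual P) p :
  rd_eval (\sum_(i <- r) phi i) p = \sum_(i <- r) rd_eval (phi i) p.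
Proof. by elim/big_rec2: _ => // i y x _ <-. Qed.

Lemma rd_evalD (P : lmodType A^c) (phi : right_dual P) p q :
  rd_eval phi (p + q) = rd_eval phi p + rd_eval phi q.
Proof. exact: raddfD. Qed.

Lemma rd_eval_ract (P : lmodType A^c) (phi : right_dual P) (a : A) p :
  rd_eval phi ((a : A^c) *: p) = rd_eval phi p * a.
Proof. by rewrite /rd_eval linearZ. Qed.

Lemma kd_evalZ (N : lmodType A) (a : A) (xi : kdual N) n :
  kd_eval ((a : A^c) *: xi) n = kd_eval xi (a *: n).
Proof. by []. Qed.

Lemma kd_eval_suml (N : lmodType A) I (r : seq I) (xi : I -> kdual N) n :
  kd_eval (\sum_(i <- r) xi i) n = \sum_(i <- r) kd_eval (xi i) n.
Proof. by elim/big_rec2: _ => // i y x _ <-. Qed.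

Lemma kd_eval0 (N : lmodType A) (xi : kdual N) : kd_eval xi 0 = 0.
Proof. exact: (raddf0 (hom_fun xi)). Qed.

Lemma kd_eval_sumr (N : lmodType A) I (r : seq I) (xi : kdual N) (n : I -> N) :
  kd_eval xi (\sum_(i <- r) n i) = \sum_(i <- r) kd_eval xi (n i).
Proof. exact: (raddf_sum (hom_fun xi)). Qed.

(** The coordinate functions of a dual basis form with the basis elements a dual basis of
    the dual module. *)
Lemma right_dual_expand (P : lmodType A^c) n (y : 'I_n -> P)
    (zeta : 'I_n -> {linear P -> (A^c)^o}) (phi : right_dual P) :
  dual_basis y zeta -> phi = \sum_j rd_eval phi (y j) *: (zeta j : right_dual P).
Proof.
move=> db; apply: homP => p; rewrite -!/(rd_eval _ p) rd_eval_sum {1}(db p).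
rewrite /rd_eval linear_sum; apply: eq_bigr => j _.
exact: rd_eval_ract.
Qed.

Variables (X P1 P0 : lmodType A^c) (f : {linear P1 -> P0}).
Variables (n1 n0 : nat) (y : 'I_n1 -> P1) (zeta : 'I_n1 -> {linear P1 -> (A^c)^o}).
Variables (g0 : 'I_n0 -> P0) (xi : 'I_n0 -> {linear P0 -> (A^c)^o}).
Hypotheses (db1 : dual_basis y zeta) (db0 : dual_basis g0 xi).
Variables (N : lmodType A) (q : {linear right_dual P1 -> N}).
Hypothesis q_surj : surjective_map q.
Hypothesis q_ker : forall phi : right_dual P1, q phi = 0 <->
  exists psi : right_dual P0, forall x, rd_eval phi x = rd_eval psi (f x).

(** The image of the tensor x (x) phi in Hom (P, X). *)
Lemma rank_one_linear (P : lmodType A^c) (x : X) (phi : right_dual P) :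
  linear (fun p => (rd_eval phi p : A^c) *: x).
Proof.
move=> a p r; rewrite rd_evalD rd_eval_ract.
by rewrite (@scalerDl A^c X) ract_mul.
Qed.

(** For phi in Hom (P1, A), the map y |-> x.phi(y) factors through f by a map h.  Expanding
    phi in the dual basis zeta of P1 and h in the dual basis xi of P0, eta x becomes a
    combination of values of eta at the elements h (g0 i), evaluated on the class of the
    composite of xi i and f, which is zero in the cokernel N. *)
Lemma hom_kdual_vanish : maps_factor X f -> forall (eta : {linear X -> kdual N}) x, eta x = 0.
Proof.
move=> fac eta x; apply: homP => n; rewrite -!/(kd_eval _ n).
have [phi <-] := q_surj n.
have [h hE] := fac (mk_linear (rank_one_linear x phi)).
rewrite {1}(right_dual_expand phi db1) linear_sum kd_eval_sumr.
have term j : kd_eval (eta x) (q (rd_eval phi (y j) *: (zeta j : right_dual P1))) =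
    \sum_i kd_eval (eta (h (g0 i))) ((xi i (f (y j)) : A) *: q (zeta j)).
  rewrite linearZ /= -kd_evalZ -linearZ /=.
  have -> : (rd_eval phi (y j) : A^c) *: x = h (f (y j)) by rewrite -hE.
  rewrite (dual_basis_linear h _ db0) linear_sum kd_eval_suml.
  by apply: eq_bigr => i _; rewrite linearZ.
under eq_bigr => j _ do rewrite term.
rewrite exchange_big /=; apply: big1 => i _.
rewrite -kd_eval_sumr.
suff -> : \sum_j (xi i (f (y j)) : A) *: q (zeta j) = 0 by rewrite kd_eval0.
have -> : \sum_j (xi i (f (y j)) : A) *: q (zeta j) =
    q (\sum_j (xi i (f (y j)) : A) *: (zeta j : right_dual P1)).
  by rewrite linear_sum; apply: eq_bigr => j _; rewrite linearZ.
apply/q_ker; exists (xi i) => p; rewrite rd_eval_sum.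
have -> : rd_eval (xi i) (f p) = rd_eval (xi i \o f : {linear _ -> _}) p by [].
rewrite (right_dual_expand (xi i \o f : {linear _ -> _}) db1) rd_eval_sum.
by [].
Qed.

End Criterion.

Section CriterionConverse.
Variables (k : fieldType) (A : algType k).
Variables (X P1 P0 : lmodType A^c) (f : {linear P1 -> P0}).
Variables (n1 : nat) (y : 'I_n1 -> P1) (zeta : 'I_n1 -> {linear P1 -> (A^c)^o}).
Hypothesis db1 : dual_basis y zeta.
Variables (N : lmodType A) (q : {linear right_dual P1 -> N}).
Hypothesis q_surj : surjective_map q.
Hypothesis q_ker : forall phi : right_dual P1, q phi = 0 <->
  exists psi : right_dual P0, forall x, rd_eval phi x = rd_eval psi (f x).

(** A map g : P1 -> X is determined by its values on the generators y of P1, that is, by a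
    vector of the power V of X.  If g does not factor, a functional lam on V vanishes on
    the vectors of the maps that factor, but not on that of g.  Then
    eta(x)(q phi) = lam (x.phi(y_j))_j defines a map eta : X -> DN, which is nonzero as g
    is a sum of maps p |-> x.phi(p). *)
Lemma vanish_maps_factor :
  (forall (eta : {linear X -> kdual N}) x, eta x = 0) -> maps_factor X f.
Proof.
move=> eta0 g; apply: contrapT => nofac.
pose V : lmodType k := {ffun 'I_n1 -> scalars X}.
pose S (v : V) := exists h : {linear P0 -> X}, forall j, v j = h (f (y j)).
have S0 : S 0 by exists \0 => j; rewrite ffunE.
have SP c u v : S u -> S v -> S (c *: u + v).
  move=> [h hE] [h' h'E].
  have lin : linear (fun p => (c *: (h p : scalars X) : X) + h' p).
    move=> a p r; rewrite !linearP scalerDr.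
    change (c *: (((a : A^c) *: h p) : scalars X) + c *: (h r : scalars X)
      + ((a : A^c) *: h' p + h' r) =
      (a : A^c) *: (((c *: (h p : scalars X)) : X) + h' p) + (c *: (h r : scalars X) + h' r)).
    by rewrite -ract_scalar (@scalerDr A^c X) (@addrACA X).
  by exists (mk_linear lin) => j; rewrite !ffunE hE h'E.
have [|lam [lamS lamg]] := @separating_functional k V S S0 SP [ffun j => g (y j)].
  move=> [h hE]; apply: nofac; exists h => p.
  rewrite (dual_basis_linear g p db1).
  have /= -> := dual_basis_linear (h \o f : {linear _ -> _}) p db1.
  by apply: eq_bigr => j _; have := hE j; rewrite ffunE => ->.
pose vec (x : X) (phi : right_dual P1) : V := [ffun j => (rd_eval phi (y j) : A^c) *: x].
have vecDl x x' phi : vec (x + x') phi = vec x phi + vec x' phi.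
  by apply/ffunP => j; rewrite !ffunE (@scalerDr A^c X).
have vecDr x phi psi : vec x (phi + psi) = vec x phi + vec x psi.
  by apply/ffunP => j; rewrite !ffunE; apply: (@scalerDl A^c X).
have vecA x (a : A) phi : vec ((a : A^c) *: x) phi = vec x (a *: phi).
  by apply/ffunP => j; rewrite !ffunE ract_mul.
have vecZ x c phi : vec x ((c%:A : A) *: phi) = c *: vec x phi.
  by apply/ffunP => j; rewrite !ffunE rd_evalZ -ract_mul -ract_scalar.
have lam_q0 x phi : q phi = 0 -> lam (vec x phi) = 0.
  move=> /q_ker [psi psiE]; apply: lamS.
  by exists (mk_linear (rank_one_linear x psi)) => j; rewrite ffunE psiE.
have lam_q x phi psi : q phi = q psi -> lam (vec x phi) = lam (vec x psi).
  move=> e; apply/eqP; rewrite -subr_eq0 -linearB /=.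
  have -> : vec x phi - vec x psi = vec x (phi - psi).
    by apply/eqP; rewrite subr_eq -vecDr subrK.
  by apply/eqP/lam_q0; rewrite linearB /= e subrr.
have [r rE] := choice q_surj.
have eta_lin x : linear (fun n : restrict_scalars N => lam (vec x (r n)) : k^o).
  move=> c n m; rewrite -linearP -vecZ -vecDr; apply: lam_q.
  by rewrite rE raddfD /= linearZ /= !rE.
pose eta x : kdual N := mk_linear (eta_lin x).
have etaE x phi : kd_eval (eta x) (q phi) = lam (vec x phi).
  by apply: lam_q; rewrite rE.
have eta_linear : linear eta.
  move=> a x x'; apply: homP => n; have [phi <-] := q_surj n.
  rewrite -!/(kd_eval _ _) etaE vecDl raddfD /= vecA -!etaE.
  by rewrite linearZ.
have lam0 x phi : lam (vec x phi) = 0.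
  have := eta0 (mk_linear eta_linear) x; rewrite /= => e.
  by rewrite -etaE e.
case/eqP: lamg.
have -> : [ffun j => g (y j)] = \sum_l vec (g (y l)) (zeta l : right_dual P1).
  apply/ffunP => j; rewrite ffunE sum_ffunE {1}(db1 (y j)) linear_sum.
  by apply: eq_bigr => l _; rewrite ffunE linearZ.
by rewrite linear_sum big1.
Qed.

End CriterionConverse.

Section TauRigid.
Variables (k : fieldType) (A : algType k).

(** Auslander-Reiten duality: Hom (X, D N) is the dual of the tensor product of X and N,
    which is the cokernel of Hom (P0, X) -> Hom (P1, X) when N is the cokernel of
    Hom (P0, A) -> Hom (P1, A). *)
Lemma tau_rigidP (X : lmodType A^c) : tau_rigid X <->
  exists (P1 P0 : lmodType A^c) (f : {linear P1 -> P0}) (p : {linear P0 -> X}),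
    minimal_presentation f p /\ maps_factor X f.
Proof.
split=> [[N [[P1 [P0 [f [p [q [mp q_surj q_ker]]]]]] eta0]]|].
  exists P1, P0, f, p; split=> //.
  have [[fg1 fg0] [pr1 pr0] _ _ _] := mp.
  have [n1 [y [zeta db1]]] := projective_dual_basis fg1 pr1.
  exact: (vanish_maps_factor db1 q_surj q_ker eta0).
move=> [P1 [P0 [f [p [mp fac]]]]].
pose S : {pred right_dual P1} := fun phi =>
  `[< exists psi : right_dual P0, forall x, rd_eval phi x = rd_eval psi (f x) >].
have S_submod : submod_closed S.
  split; first by apply/asboolP; exists 0.
  move=> a phi phi' /asboolP [psi psiE] /asboolP [psi' psi'E].
  apply/asboolP; exists (a *: psi + psi') => x.
  rewrite -[LHS]/(a * rd_eval phi x + rd_eval phi' x).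
  by rewrite psiE psi'E.
have [N [q [q_surj q_ker]]] := quotient_module S_submod.
have {}q_ker phi : q phi = 0 <-> exists psi : right_dual P0,
    forall x, rd_eval phi x = rd_eval psi (f x).
  by rewrite q_ker; split => /asboolP.
exists N; split; first by exists P1, P0, f, p, q.
have [[fg1 fg0] [pr1 pr0] _ _ _] := mp.
have [n1 [y [zeta db1]]] := projective_dual_basis fg1 pr1.
have [n0 [g0 [xi db0]]] := projective_dual_basis fg0 pr0.
exact: (hom_kdual_vanish db1 db0 q_surj q_ker fac).
Qed.

End TauRigid.

(** * Modules over the skew group algebra as modules with a semilinear involution *)

Definition semilinear (k : comNzRingType) (A : algType k) (s : {lrmorphism A -> A})
    (P : lmodType A^c) (S : P -> P) : Prop :=
  (forall x y, S (x + y) = S x + S y) /\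
  (forall (a : A) x, S ((a : A^c) *: x) = (s a : A^c) *: S x).

Definition semilinear_involution (k : comNzRingType) (A : algType k)
    (s : {lrmorphism A -> A}) (P : lmodType A^c) (S : P -> P) : Prop :=
  [/\ forall x y, S (x + y) = S x + S y,
      forall (a : A) x, S ((a : A^c) *: x) = (s a : A^c) *: S x &
      forall x, S (S x) = x].

Lemma involution_semilinear (k : comNzRingType) (A : algType k)
    (s : {lrmorphism A -> A}) (P : lmodType A^c) (S : P -> P) :
  semilinear_involution s S -> semilinear s S.
Proof. by case. Qed.

Section Halve.
Variables (k : fieldType) (A : algType k).
Hypothesis two_neq0 : (2%:R : k) != 0.
Variable s : {lrmorphism A -> A}.
Implicit Types P Z : lmodType A^c.

(** Half of x; the scalar 1/2 acts through A, so that A-linear maps and semilinear maps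
    commute with it. *)
Definition halve P (x : P) : P := (2%:R^-1 : k) *: (x : scalars P).

Lemma halveD P (x y : P) : halve (x + y) = halve x + halve y.
Proof. exact: scalerDr. Qed.

Lemma halve_double P (x : P) : halve (x + x) = x.
Proof.
rewrite /halve -[_ + _]/((x : scalars P) + x) -mulr2n -scaler_nat scalerA.
by rewrite mulVf // scale1r.
Qed.

Lemma halve0 P : halve (0 : P) = 0.
Proof. exact: (@scaler0 k (scalars P)). Qed.

Lemma halveN P (x : P) : halve (- x) = - halve x.
Proof. exact: scalerN. Qed.

Lemma halve_ract P (a : A) (x : P) : halve ((a : A^c) *: x) = (a : A^c) *: halve x.
Proof. by rewrite /halve -ract_scalar. Qed.

Lemma halve_linear P Z (f : {linear P -> Z}) x : halve (f x) = f (halve x).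
Proof. by rewrite /halve linear_scalars. Qed.

Lemma semilinear0 P (S : P -> P) : semilinear s S -> S 0 = 0.
Proof. by move=> [SD _]; apply: (addIr (S 0)); rewrite -SD !add0r. Qed.

Lemma semilinearN P (S : P -> P) x : semilinear s S -> S (- x) = - S x.
Proof.
by move=> [_ SZ]; have := SZ (-1) x; rewrite rmorphN1 !(@scaleN1r A^c P).
Qed.

Lemma semilinear_halve P (S : P -> P) x : semilinear s S -> S (halve x) = halve (S x).
Proof.
move=> [_ SZ]; rewrite /halve !scalars_scaleE SZ.
by rewrite linearZ /= rmorph1.
Qed.

Section Average.
Variables (P Z : lmodType A^c) (S : P -> P) (T : Z -> Z).
Hypotheses (SI : semilinear_involution s S) (TI : semilinear_involution s T).
Hypothesis s_invol : forall a, s (s a) = a.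
Variable f : {linear P -> Z}.

Lemma conjugate_linear : linear (fun x => T (f (S x))).
Proof.
have [[SD SZ _] [TD TZ _]] := (SI, TI).
by move=> a x y; rewrite SD SZ linearD linearZ /= TD TZ s_invol.
Qed.

Lemma even_linear : linear (fun x => halve (f x + T (f (S x)))).
Proof.
move=> a x y; rewrite linearP conjugate_linear addrACA -scalerDr.
by rewrite halveD halve_ract.
Qed.

Lemma odd_linear : linear (fun x => halve (f x - T (f (S x)))).
Proof.
move=> a x y; rewrite linearP conjugate_linear opprD addrACA -scalerBr.
by rewrite halveD halve_ract.
Qed.

Definition even_part : {linear P -> Z} := mk_linear even_linear.
Definition odd_part : {linear P -> Z} := mk_linear odd_linear.

Lemma even_add_odd x : even_part x + odd_part x = f x.
Proof. by rewrite !mk_linearE -halveD addrACA subrr addr0 halve_double. Qed.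

Lemma even_part_comm x : even_part (S x) = T (even_part x).
Proof.
have [[SD SZ SS] [TD TZ TT]] := (SI, TI).
by rewrite !mk_linearE (semilinear_halve _ (involution_semilinear TI)) TD TT SS addrC.
Qed.

Lemma odd_part_comm x : odd_part (S x) = - T (odd_part x).
Proof.
have [[SD SZ SS] [TD TZ TT]] := (SI, TI).
rewrite !mk_linearE (semilinear_halve _ (involution_semilinear TI)) TD.
rewrite (semilinearN _ (involution_semilinear TI)) TT SS.
by rewrite -halveN opprB.
Qed.

End Average.
End Halve.

Section Skew.
Variables (k : fieldType) (A : algType k) (gT : finGroupType) (sigma : gT).
Hypotheses (sigma_neq1 : sigma != 1%g) (G_eq : [set: gT]%SET = [set 1%g; sigma]%SET).
Variable act : alg_action gT A.
Local Notation B := (skew_algebra act).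
Local Notation s := (act sigma).
Local Notation inc := (skew_incl act).
Local Notation w := (skew_tensor act 1 sigma : B).

Lemma order2P (g : gT) : g = 1%g \/ g = sigma.
Proof.
have : g \in [set: gT]%SET by rewrite inE.
by rewrite G_eq !inE => /orP [] /eqP; [left|right].
Qed.

Lemma sigma_sq : (sigma * sigma = 1)%g.
Proof.
have [//|e] := order2P (sigma * sigma)%g.
by case/eqP: sigma_neq1; apply: (mulgI sigma); rewrite mulg1.
Qed.

Lemma act_invol a : s (s a) = a.
Proof. by rewrite -alg_actM sigma_sq alg_act1. Qed.

Lemma inc1 : inc 1 = 1 :> B.
Proof. by []. Qed.

Lemma incM a b : inc a * inc b = inc (a * b) :> B.
Proof. by rewrite -[LHS]/(skew_mul _ _) skew_tensorM alg_act1 mulg1. Qed.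

Lemma incD a b : inc (a + b) = inc a + inc b :> B.
Proof. by apply/ffunP => x; rewrite !ffunE; case: eqP; rewrite ?addr0. Qed.

Lemma ww : w * w = 1 :> B.
Proof. by rewrite -[LHS]/(skew_mul _ _) skew_tensorM rmorph1 mulr1 sigma_sq. Qed.

Lemma w_inc a : w * inc a = inc (s a) * w :> B.
Proof.
rewrite -[LHS]/(skew_mul _ _) -[RHS]/(skew_mul _ _) !skew_tensorM.
by rewrite mul1r mul1g mulg1 rmorph1 mulr1.
Qed.

(** AG is free as a left A-module on 1 and w = 1 (x) sigma. *)
Lemma skew_decomp (b : B) : b = inc (b 1%g) + inc (b sigma) * w.
Proof.
rewrite -[_ * w]/(skew_mul _ _) skew_tensorM mul1g rmorph1 mulr1.
apply/ffunP => g; rewrite !ffunE; have [->|->] := order2P g.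
  by rewrite eqxx [_ == sigma]eq_sym (negbTE sigma_neq1) addr0.
by rewrite eqxx (negbTE sigma_neq1) add0r.
Qed.

Section Restriction.
Variable Y : lmodType B^c.

(** The restriction of Y to A, along [skew_incl]. *)
Definition skew_res : Type := Y.

HB.instance Definition _ := GRing.Zmodule.on skew_res.

Definition skew_res_scale (a : A^c) (y : skew_res) : skew_res := (inc a : B^c) *: (y : Y).

Lemma skew_ract_mul (a b : B) (y : Y) :
  (b : B^c) *: ((a : B^c) *: y) = ((a * b : B) : B^c) *: y.
Proof. by rewrite scalerA. Qed.

Fact skew_res_scaleA a b y : skew_res_scale a (skew_res_scale b y) = skew_res_scale (a * b) y.
Proof. by rewrite /skew_res_scale skew_ract_mul incM. Qed.
Fact skew_res_scale1 : left_id 1 skew_res_scale.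
Proof. by move=> y; rewrite /skew_res_scale inc1; apply: (@scale1r B^c Y). Qed.
Fact skew_res_scaleDr : right_distributive skew_res_scale +%R.
Proof. by move=> a x y; rewrite /skew_res_scale scalerDr. Qed.
Fact skew_res_scaleDl y : {morph skew_res_scale^~ y : a b / a + b}.
Proof. by move=> a b; rewrite /skew_res_scale incD; apply: (@scalerDl B^c Y). Qed.

HB.instance Definition _ := GRing.Zmodule_isLmodule.Build A^c skew_res
  skew_res_scaleA skew_res_scale1 skew_res_scaleDr skew_res_scaleDl.

Definition skew_swap (y : skew_res) : skew_res := (w : B^c) *: (y : Y).

Lemma skew_swapI : semilinear_involution s skew_swap.
Proof.
split=> [x y|a y|y]; rewrite /skew_swap; first by rewrite scalerDr.
- by rewrite -![_ *: (_ : skew_res)]/((inc _ : B^c) *: (_ : Y)) !skew_ract_mul w_inc act_invol.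
- by rewrite skew_ract_mul ww; apply: (@scale1r B^c Y).
Qed.

Lemma skew_scaleE (b : B) (y : Y) :
  (b : B^c) *: y = ((b 1%g : A^c) *: (y : skew_res))
     + skew_swap ((b sigma : A^c) *: (y : skew_res)) :> skew_res.
Proof.
rewrite /skew_swap -![_ *: (_ : skew_res)]/((inc _ : B^c) *: (_ : Y)) skew_ract_mul.
by rewrite [in LHS](skew_decomp b); apply: (@scalerDl B^c Y).
Qed.

End Restriction.

Lemma skew_res_linear (Y Z : lmodType B^c) (f : {linear Y -> Z}) :
  linear (f : skew_res Y -> skew_res Z).
Proof. by move=> a x y; apply: linearP. Qed.

(** The action of B is made of that of A and of the swap, see [skew_scaleE]. *)
Lemma skew_linear (Y Z : lmodType B^c) (f : {linear skew_res Y -> skew_res Z}) :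
  (forall y, f (skew_swap y) = skew_swap (f y)) -> linear (f : Y -> Z).
Proof.
move=> fs b x y; rewrite -[LHS]/(f (_ + (y : skew_res Y))) linearD; congr (_ + _).
by rewrite (skew_scaleE b x) (skew_scaleE b (f x)) linearD fs !linearZ.
Qed.

Section Extension.
Variables (P : lmodType A^c) (S : P -> P).
Hypothesis SI : semilinear_involution s S.

(** P as a B-module, with w acting as the involution S.  The hypotheses on the group are
    parameters of the type, because the module structure depends on them. *)
Definition skew_ext_of (_ : sigma != 1%g) (_ : [set: gT]%SET = [set 1%g; sigma]%SET)
  (_ : semilinear_involution s S) : Type := P.
Local Notation PS := (skew_ext_of sigma_neq1 G_eq SI).

HB.instance Definition _ := GRing.Zmodule.on PS.

Definition skew_ext_scale (b : B^c) (x : PS) : PS :=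
  ((b : B) 1%g : A^c) *: (x : P) + S (((b : B) sigma : A^c) *: (x : P)).

Lemma skew_mul1 (a b : B) : (a * b) 1%g = a 1%g * b 1%g + a sigma * s (b sigma).
Proof.
rewrite ffunE (bigD1 1%g) //= (bigD1 sigma) //= big1 ?addr0; last first.
  by move=> g /andP[/eqP g1 /eqP gs]; case: (order2P g).
have sigmaV : (sigma^-1 = sigma)%g by apply: (mulgI sigma); rewrite mulgV sigma_sq.
by rewrite alg_act1 invg1 !mulg1 sigmaV.
Qed.

Lemma skew_mulsigma (a b : B) : (a * b) sigma = a 1%g * b sigma + a sigma * s (b 1%g).
Proof.
rewrite ffunE (bigD1 1%g) //= (bigD1 sigma) //= big1 ?addr0; last first.
  by move=> g /andP[/eqP g1 /eqP gs]; case: (order2P g).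
by rewrite alg_act1 invg1 !mul1g mulVg.
Qed.

Fact skew_ext_scaleA a b x : skew_ext_scale a (skew_ext_scale b x) = skew_ext_scale (a * b) x.
Proof.
have [SD SZ SS] := SI.
rewrite /skew_ext_scale -[(a * b : B^c)]/((b : B) * (a : B)) skew_mul1 skew_mulsigma.
rewrite !scalerDr !ract_mul.
rewrite !(@scalerDl A^c P) !SD !SZ SS !ract_mul !rmorphM /= !act_invol.
by rewrite [X in _ + X]addrC addrACA [X in _ + X]addrC.
Qed.
Fact skew_ext_scale1 : left_id 1 skew_ext_scale.
Proof.
move=> x; rewrite /skew_ext_scale !ffunE eqxx (negbTE sigma_neq1).
by rewrite (@scale1r A^c P) (@scale0r A^c P) (semilinear0 (involution_semilinear SI)) addr0.
Qed.
Fact skew_ext_scaleDr : right_distributive skew_ext_scale +%R.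
Proof.
have [SD SZ SS] := SI.
by move=> a x y; rewrite /skew_ext_scale !scalerDr SD addrACA.
Qed.
Fact skew_ext_scaleDl x : {morph skew_ext_scale^~ x : a b / a + b}.
Proof.
have [SD SZ SS] := SI.
move=> a b; rewrite /skew_ext_scale !ffunE.
by rewrite !(@scalerDl A^c P) SD addrACA.
Qed.

HB.instance Definition _ := GRing.Zmodule_isLmodule.Build B^c PS
  skew_ext_scaleA skew_ext_scale1 skew_ext_scaleDr skew_ext_scaleDl.

Lemma skew_ext_inc (a : A) (x : PS) : (inc a : B^c) *: x = (a : A^c) *: (x : P) :> P.
Proof.
rewrite -[LHS]/(skew_ext_scale _ _) /skew_ext_scale !ffunE eqxx (negbTE sigma_neq1).
by rewrite (@scale0r A^c P) (semilinear0 (involution_semilinear SI)) addr0.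
Qed.

Lemma skew_ext_swap (x : PS) : (w : B^c) *: x = S x :> P.
Proof.
rewrite -[LHS]/(skew_ext_scale _ _) /skew_ext_scale !ffunE eqxx.
rewrite [_ == sigma]eq_sym (negbTE sigma_neq1).
by rewrite (@scale0r A^c P) (@scale1r A^c P) add0r.
Qed.

End Extension.
End Skew.

(** * Restricting minimal presentations to A *)

(** The image of 1 - a and K span P. *)
Lemma superfluous_sub_surj (R : pzRingType) (P : lmodType R) (K : P -> Prop)
    (a : {linear P -> P}) : superfluous K -> (forall x, K (a x)) ->
  forall y, exists x, y = x - a x.
Proof.
move=> supK Ka y; pose L : {pred P} := fun y => `[< exists x, y = x - a x >].
suff /asboolP : y \in L by [].
apply: supK y => [|y].
- split; first by apply/asboolP; exists 0; rewrite linear0 subrr.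
  move=> c _ _ /asboolP [x ->] /asboolP [z ->]; apply/asboolP.
  by exists (c *: x + z); rewrite linearP opprD addrACA scalerBr.
- exists (a y), (y - a y); split=> //; last by rewrite addrC subrK.
  by apply/asboolP; exists y.
Qed.

Section TauIso.
Variables (k : fieldType) (A : algType k).

Lemma tau_rigid_iso (X Y : lmodType A^c) (u : {linear X -> Y}) (v : {linear Y -> X}) :
  cancel u v -> cancel v u -> tau_rigid X -> tau_rigid Y.
Proof.
move=> uK vK /tau_rigidP [P1 [P0 [f [p [[fg pr [p_surj ex] sup0 sup1] fac]]]]].
apply/tau_rigidP; exists P1, P0, f, (u \o p : {linear _ -> _}).
have ker x : (u \o p) x = 0 <-> p x = 0.
  by split=> /= [e|->]; [rewrite -[LHS]uK e|]; rewrite linear0.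
split; last first.
  move=> g; have [h hE] := fac (v \o g : {linear _ -> _}).
  by exists (u \o h : {linear _ -> _}) => y /=; rewrite -hE /= vK.
split=> //; first split.
- by move=> y; have [x xE] := p_surj (v y); exists x; rewrite /= xE vK.
- by move=> x; rewrite ker; apply: ex.
- move=> L Lsub cov; apply: sup0 => // x; have [y [z [Ky Lz ->]]] := cov x.
  by exists y, z; split=> //; apply/ker.
Qed.

End TauIso.

Section RestrictRigid.
Variables (k : fieldType) (A : algType k) (gT : finGroupType) (sigma : gT).
Hypothesis two_neq0 : (2%:R : k) != 0.
Hypotheses (sigma_neq1 : sigma != 1%g) (G_eq : [set: gT]%SET = [set 1%g; sigma]%SET).
Variable act : alg_action gT A.
Local Notation B := (skew_algebra act).
Local Notation s := (act sigma).
Local Notation inc := (skew_incl act).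
Local Notation w := (skew_tensor act 1 sigma : B).
Local Notation swapI Y := (@skew_swapI _ _ _ _ sigma_neq1 G_eq act Y).
Local Notation act_invol := (act_invol sigma_neq1 G_eq act).
Local Notation swap := (@skew_swap _ _ _ sigma act _).

Section DualBasisRestriction.
Variables (P : lmodType B^c) (n : nat) (g : 'I_n -> P) (xi : 'I_n -> {linear P -> (B^c)^o}).
Hypothesis db : dual_basis g xi.

Let coef i (x : P) : B := xi i x.

Lemma coef_inc i (a : A) (x y : skew_res P) :
  coef i ((a : A^c) *: x + y) = coef i x * inc a + coef i y.
Proof. exact: linearP. Qed.

Lemma coef1_linear i : linear (fun x : skew_res P => coef i x 1%g : (A^c)^o).
Proof.
move=> a x y; rewrite coef_inc [LHS]ffunE (skew_mul1 sigma_neq1 G_eq).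
rewrite !ffunE eqxx (negbTE sigma_neq1) rmorph0 mulr0 addr0.
by [].
Qed.

Lemma coefs_linear i : linear (fun x : skew_res P => s (coef i x sigma) : (A^c)^o).
Proof.
move=> a x y; rewrite coef_inc [in LHS]ffunE (skew_mulsigma sigma_neq1 G_eq).
rewrite !ffunE eqxx (negbTE sigma_neq1) mulr0 add0r.
by rewrite rmorphD rmorphM /= act_invol.
Qed.

(** B is free over A on 1 and w, so every generator over B yields two over A. *)
Definition res_gen (j : 'I_(n + n)) : skew_res P :=
  match split j with inl i => g i | inr i => swap (g i) end.
Definition res_coord (j : 'I_(n + n)) : {linear skew_res P -> (A^c)^o} :=
  match split j with
  | inl i => mk_linear (@coef1_linear i)
  | inr i => mk_linear (@coefs_linear i)
  end.

Lemma skew_res_dual_basis : dual_basis res_gen res_coord.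
Proof.
move=> x; rewrite big_split_ord /=.
rewrite [LHS](db x) -big_split /=; apply: eq_bigr => i _.
rewrite /res_gen /res_coord (unsplitK (inl _ i)) (unsplitK (inr _ i)) !mk_linearE.
have -> := skew_scaleE sigma_neq1 G_eq (xi i x) (g i); congr (_ + _).
by have [_ -> _] := swapI P.
Qed.

End DualBasisRestriction.

Lemma skew_res_fg_projective (P : lmodType B^c) :
  finitely_generated P -> projective P ->
  finitely_generated (skew_res P) /\ projective (skew_res P).
Proof.
move=> fg pr; have [n [g [xi db]]] := projective_dual_basis fg pr.
have db' := skew_res_dual_basis db.
by split; [apply: dual_basis_fg db'|apply: dual_basis_projective db'].
Qed.

(** It suffices to find, for a submodule L that spans P together with ker u, an A-linear
    phi with values in ker u such that 1 - phi is onto and has values in L.  Such a phi is given by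
    the components in ker u of the elements of a dual basis.  Surjectivity is known for
    even maps only, as these are B-linear; it is derived for 1 - phi from the even part a
    of phi and from the square of the odd map b'. *)
Lemma skew_res_superfluous (P Z : lmodType B^c) (u : {linear P -> Z}) :
  finitely_generated P -> projective P ->
  superfluous (fun x : P => u x = 0) ->
  superfluous (fun x : skew_res P => (u : skew_res P -> skew_res Z) x = 0).
Proof.
move=> fg pr supu L Lsub cov y.
have [fgA prA] := skew_res_fg_projective fg pr.
have [n [g [xi db]]] := projective_dual_basis fgA prA.
pose uA : {linear skew_res P -> skew_res Z} := mk_linear (skew_res_linear u).
have /fin_all_exists2 [ka kaK kaL] : forall i, exists2 z : skew_res P, uA z = 0 & g i - z \in L.
  move=> i; have [z [l [Kz Ll ->]]] := cov (g i).
  by exists z => //; rewrite addrC addKr.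
pose phi := mk_linear (linear_combination_linear xi ka).
have uphi x : uA (phi x) = 0.
  by rewrite mk_linearE linear_sum big1 // => i _; rewrite linearZ /= kaK scaler0.
have Lphi x : x - phi x \in L.
  have -> : x - phi x = \sum_i (xi i x : A^c) *: (g i - ka i).
    rewrite {1}(db x) mk_linearE -sumrB; apply: eq_bigr => i _.
    by rewrite scalerBr.
  have [L0 LP] := Lsub; elim/big_rec: _ => // i z _ Lz.
  exact: LP.
pose a := even_part (swapI P) (swapI P) act_invol phi.
pose b := odd_part (swapI P) (swapI P) act_invol phi.
have aS x : a (swap x) = swap (a x) by apply: even_part_comm.
have bS x : b (swap x) = - swap (b x) by apply: odd_part_comm.
have ab x : phi x = a x + b x by rewrite even_add_odd.
have uswap x : uA (swap x) = swap (uA x) by apply: linearZ.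
have swap0 : swap (0 : skew_res Z) = 0 := semilinear0 (involution_semilinear (swapI Z)).
have ua x : uA (a x) = 0.
  rewrite -[a x]/(halve (phi x + swap (phi (swap x)))) -halve_linear linearD uswap.
  by rewrite !uphi swap0 addr0 halve0.
have ub x : uA (b x) = 0.
  rewrite -[b x]/(halve (phi x - swap (phi (swap x)))) -halve_linear linearB uswap.
  by rewrite !uphi swap0 subr0 halve0.
pose aB : {linear P -> P} := mk_linear (skew_linear sigma_neq1 G_eq aS).
have one_sub_a : linear (fun x : P => x - aB x).
  by move=> c x z; rewrite linearP opprD addrACA scalerBr.
(* As P is projective over B, the map 1 - a, which is onto, has a right inverse v. *)
have [|v vE] := pr _ _ (mk_linear one_sub_a) (idfun : {linear P -> P}).
  by move=> z; have [x ->] := superfluous_sub_surj supu (ua : forall x, u (aB x) = 0) z; exists x.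
pose vA : {linear skew_res P -> skew_res P} := mk_linear (skew_res_linear v).
have {}vE z : vA z - a (vA z) = z by apply: vE.
have vS x : vA (swap x) = swap (vA x) by apply: linearZ.
pose b' : {linear skew_res P -> skew_res P} := (b \o vA : {linear _ -> _}).
have b'S1 x : b' (swap x) = - swap (b' x) by rewrite -[LHS]/(b (vA (swap x))) vS bS.
have b'S x : b' (b' (swap x)) = swap (b' (b' x)) by rewrite b'S1 linearN b'S1 opprK.
pose b2 : {linear P -> P} :=
  mk_linear (skew_linear (f := (b' \o b' : {linear _ -> _})) sigma_neq1 G_eq b'S).
have [|x yE] := superfluous_sub_surj (a := b2) supu _ y; first by move=> z; apply: ub.
(* (1 - b') (1 + b') x = x - b' (b' x) = y, and (1 - phi) v = 1 - b'. *)
pose t : skew_res P := x + b' x.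
have -> : y = vA t - phi (vA t).
  by rewrite ab opprD addrA vE -[b (vA t)]/(b' t) linearD opprD addrA addrK.
exact: Lphi.
Qed.

(** The odd part o of a map g to Y becomes even, hence B-linear, on composing it with eps;
    so it also factors through f. *)
Lemma tau_rigid_restrict (Y : lmodType B^c) (eps : {linear skew_res Y -> skew_res Y}) :
  (forall y, eps (eps y) = y) -> (forall y, eps (swap y) = - swap (eps y)) ->
  tau_rigid Y -> tau_rigid (skew_res Y).
Proof.
move=> epsK epsS /tau_rigidP [P1 [P0 [f [p [mp fac]]]]].
have [[fg1 fg0] [pr1 pr0] [p_surj ex] sup0 sup1] := mp.
have [fgA1 prA1] := skew_res_fg_projective fg1 pr1.
have [fgA0 prA0] := skew_res_fg_projective fg0 pr0.
apply/tau_rigidP; exists (skew_res P1), (skew_res P0).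
exists (mk_linear (skew_res_linear f)), (mk_linear (skew_res_linear p)); split.
  split=> //; [exact: (skew_res_superfluous fg0 pr0 sup0)
              |exact: (skew_res_superfluous fg1 pr1 sup1)].
move=> g.
pose e := even_part (swapI P1) (swapI Y) act_invol g.
pose o := odd_part (swapI P1) (swapI Y) act_invol g.
have eS x : e (swap x) = swap (e x) by apply: even_part_comm.
have oS x : eps (o (swap x)) = swap (eps (o x)).
  have -> : o (swap x) = - swap (o x) by apply: odd_part_comm.
  by rewrite linearN epsS opprK.
have [h0 h0E] := fac (mk_linear (skew_linear sigma_neq1 G_eq eS)).
have [h1 h1E] := fac (mk_linear
  (skew_linear (f := (eps \o o : {linear _ -> _})) sigma_neq1 G_eq oS)).
exists (mk_linear (skew_res_linear h0) \+
        (eps \o mk_linear (skew_res_linear h1) : {linear _ -> _})) => y.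
have eE : e y = h0 (f y) by apply: h0E.
have oE : eps (o y) = h1 (f y) by apply: h1E.
by rewrite -(even_add_odd two_neq0 (swapI P1) (swapI Y) act_invol g) -/e -/o eE -(epsK (o y)) oE.
Qed.

End RestrictRigid.

(** * Lifting involutions to projective covers *)

Section FiniteDimension.
Variables (k : closedFieldType) (A : algType k).
Hypothesis fdA : finite_span A.
Implicit Types P Z : lmodType A^c.

Lemma fg_finite_span P : finitely_generated P -> finite_span (scalars P).
Proof.
move=> [m [g gP]]; have [n [e eP]] := fdA.
apply: (@finite_span_finType _ (scalars P) _
  (fun ij : 'I_m * 'I_n => (e ij.2 : A^c) *: g ij.1 : scalars P)) => x.
have [a ->] := gP x.
have /fin_all_exists [c cE] := fun j => eP (a j).
exists (fun ij => c ij.1 0 ij.2).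
rewrite -(pair_bigA _ (fun j i => c j 0 i *: ((e i : A^c) *: g j : scalars P))) /=.
apply: eq_bigr => j _; rewrite {1}cE (@scaler_suml A^c P).
apply: eq_bigr => i _; rewrite scalars_scaleE ract_mul.
by rewrite -scalerAr mulr1.
Qed.

Section Nilpotent.
Variables (P : lmodType A^c) (K : P -> Prop) (d : {linear P -> P}).
Hypotheses (fgP : finitely_generated P) (supK : superfluous K) (Kd : forall x, K (d x)).
Hypothesis KZ : forall c x, K x -> K (c *: (x : scalars P)).

Let step (x : scalars P) (l : k) : scalars P := d x - l *: x.

(** d - l is a nonzero multiple of 1 - d/l, and d/l has values in K. *)
Lemma step_surj l : l != 0 -> forall y, exists x, y = step x l.
Proof.
move=> l0 y.
have lin : linear (fun x : P => l^-1 *: (d x : scalars P) : P).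
  by move=> a x z; rewrite linearP scalerDr -ract_scalar.
have Kl x : K (mk_linear lin x) by apply: KZ.
have [x xE] := superfluous_sub_surj supK Kl (- l^-1 *: (y : scalars P)).
exists x; rewrite /step; apply: (scalerI (invr_neq0 l0)); apply: oppr_inj.
rewrite -scaleNr [LHS]xE mk_linearE scalerBr scalerA mulVf // scale1r opprB.
by [].
Qed.

Lemma step_d (x : scalars P) r : foldl step (d x) r = d (foldl step x r).
Proof.
elim: r x => //= l r IH x; rewrite -IH; congr (foldl _ _ _).
by rewrite /step linearB -linear_scalars.
Qed.

(** By Cayley-Hamilton, a product of factors d - l vanishes on P; those with l nonzero are
    onto and can be left out, which leaves a power of d. *)
Lemma superfluous_nilpotent : exists n, forall x, iter n d x = 0.
Proof.
have [n [e eP]] := fg_finite_span fgP.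
pose ev (v : 'rV[k]_n) : scalars P := \sum_i v 0 i *: e i.
have evD u v : ev (u + v) = ev u + ev v.
  by rewrite /ev -big_split; apply: eq_bigr => i _; rewrite mxE scalerDl.
have evZ c v : ev (c *: v) = c *: ev v.
  by rewrite /ev scaler_sumr; apply: eq_bigr => i _; rewrite mxE scalerA.
case: n => [|n] in e eP ev evD evZ *.
  by exists 0%N => x; have [c ->] := eP x; rewrite big_ord0.
have /fin_all_exists [m mE] := fun i => eP (d (e i)).
pose M := \matrix_i m i.
have evM v : d (ev v) = ev (v *m M).
  rewrite mulmx_sum_row /ev linear_sum.
  transitivity (\sum_i v 0 i *: ev (m i)).
    by apply: eq_bigr => i _; rewrite linear_scalars mE.
  rewrite -[RHS]/(ev _) (big_morph ev evD (id1 := 0)).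
    by apply: eq_bigr => i _; rewrite evZ rowK.
  by apply: big1 => i _; rewrite mxE scale0r.
have evstep v l : step (ev v) l = ev (v *m (M - l%:M)).
  by rewrite /step evM -evZ -scaleN1r -evZ -evD mulmxBr mul_mx_scalar scaleN1r.
have [r rE] := closed_field_poly_normal (char_poly M).
rewrite (monicP (char_poly_monic M)) scale1r in rE.
have fold0 x : foldl step x r = 0.
  have foldE v r' : foldl step (ev v) r' = ev (v *m horner_mx M (\prod_(z <- r') ('X - z%:P))).
    elim: r' v => [|l r' IH] v; first by rewrite big_nil rmorph1 mulmx1.
    rewrite /= evstep IH big_cons rmorphM rmorphB /= horner_mx_X horner_mx_C.
    by rewrite mulmxA.
  have [c ->] := eP x; rewrite -/(ev c) foldE -rE Cayley_Hamilton mulmx0.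
  by apply: big1 => i _; rewrite mxE scale0r.
suff H N : (forall x, iter N d (foldl step x r) = 0) -> exists n, forall x, iter n d x = 0.
  exact: (H 0%N fold0).
elim: r {rE fold0} N => [|l r IH] N /= itN; first by exists N.
have [l0|l0] := eqVneq l 0; last first.
  by apply: (IH N) => y; have [x ->] := step_surj l0 y; apply: itN.
apply: (IH N.+1) => x; rewrite iterSr -step_d.
by rewrite -[RHS](itN x) /step l0 scale0r subr0.
Qed.

End Nilpotent.

End FiniteDimension.

Lemma newton_identity (V : zmodType) (x p q r t : V) :
  x - p - (p - r) + (p + p - q - (q - t)) - x = - (q + q) + (r + t).
Proof.
rewrite !opprD !opprK !addrA [LHS]addrC !addrA addNr add0r.
by rewrite -!addrA [r + (p + _)]addrCA addKr [r + (p + _)]addrCA addKr addrCA [r + _]addrCA.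
Qed.

Lemma halve_newton_identity (k : fieldType) (A : algType k) (P : lmodType A^c)
    (two_neq0 : (2%:R : k) != 0) (x a b c : P) :
  x - halve a - halve (a - halve b) + (a - halve b - halve (b - halve c)) - x =
  - b + halve (halve (b + c)).
Proof.
rewrite !halveD !halveN -{3}[a](halve_double two_neq0) halveD newton_identity.
by rewrite -(halveD b) (halve_double two_neq0).
Qed.

Section LiftInvolution.
Variables (k : closedFieldType) (A : algType k).
Hypotheses (two_neq0 : (2%:R : k) != 0) (fdA : finite_span A).
Variable s : {lrmorphism A -> A}.
Hypothesis s_invol : forall a, s (s a) = a.

Variables (P Z : lmodType A^c) (T : Z -> Z) (u : {linear P -> Z}).
Hypotheses (fgP : finitely_generated P) (prP : projective P).
Hypothesis supu : superfluous (fun x => u x = 0).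
Hypothesis TI : semilinear_involution s T.
Hypothesis Tu : forall x, exists z, u z = T (u x).

(** The images of the elements of a dual basis are lifted, and extended semilinearly. *)
Lemma semilinear_lift : exists2 S : P -> P, semilinear s S & forall x, u (S x) = T (u x).
Proof.
have [TD TZ _] := TI.
have [n [g [xi db]]] := projective_dual_basis fgP prP.
have /fin_all_exists [z zE] := fun i => Tu (g i).
exists (fun x => \sum_i (s (xi i x) : A^c) *: z i).
  split=> [x y|a x].
    rewrite -big_split /=; apply: eq_bigr => i _.
    by rewrite linearD rmorphD (@scalerDl A^c P).
  rewrite scaler_sumr; apply: eq_bigr => i _.
  by rewrite linearZ ract_mul -rmorphM.
move=> x; rewrite linear_sum (dual_basis_linear u x db).
rewrite (big_morph T TD (semilinear0 (involution_semilinear TI))).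
by apply: eq_bigr => i _; rewrite linearZ /= zE TZ.
Qed.

Section Newton.
Variable S : P -> P.
Hypothesis SL : semilinear s S.

Lemma defect_linear : linear (fun x => S (S x) - x).
Proof.
have [SD SZ] := SL.
by move=> a x y; rewrite SD SZ SD SZ s_invol opprD addrACA scalerBr.
Qed.

(** The deviation of S from being an involution. *)
Definition defect : {linear P -> P} := mk_linear defect_linear.

(** S (3 - S^2) / 2, that is S (1 - d/2), where d is the defect S^2 - 1: a Newton step for
    the equation S^2 = 1. *)
Definition newton_step (x : P) : P := S (x - halve (defect x)).

Lemma newton_step_semilinear : semilinear s newton_step.
Proof.
have [SD SZ] := SL; split=> [x y|a x]; rewrite /newton_step.
  by rewrite linearD halveD opprD addrACA; apply: SD.
have E : defect ((a : A^c) *: x) = (a : A^c) *: defect x by apply: linearZ.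
rewrite E; have -> : halve ((a : A^c) *: defect x) = (a : A^c) *: halve (defect x).
  exact: halve_ract.
by rewrite -SZ scalerBr.
Qed.

Lemma defect_comm x : defect (S x) = S (defect x).
Proof.
have [SD _] := SL; rewrite -[LHS]/(S (S (S x)) - S x) -(semilinearN _ SL) -SD.
by [].
Qed.

(** The defect of the Newton step is d^2 (d - 3) / 4, see [newton_defect]; this is the
    factor (d - 3) / 4. *)
Definition newton_factor (v : P) : P := - v + halve (halve (v + defect v)).

Lemma newton_defect x :
  newton_step (newton_step x) - x = newton_factor (defect (defect x)).
Proof.
have [SD SZ] := SL.
have SS y : S (S y) = y + defect y by rewrite mk_linearE addrC subrK.
rewrite /newton_step; have [y yE] : exists y, y = x - halve (defect x).
  by exists (x - halve (defect x)).
rewrite -yE.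
rewrite defect_comm -(semilinear_halve _ SL) -(semilinearN _ SL) -SD SS.
pose d1 := defect x; pose d2 := defect d1; pose d3 := defect d2.
have dB a b : defect (a - b) = defect a - defect b by apply: linearB.
have dh a : defect (halve a) = halve (defect a) by rewrite halve_linear.
have dy : defect y = d1 - halve d2 by rewrite yE dB dh.
have ddy : defect (defect y) = d2 - halve d3 by rewrite dy dB dh.
rewrite dB dh ddy dy yE; exact: halve_newton_identity.
Qed.

Lemma defect_newton_factor v : defect (newton_factor v) = newton_factor (defect v).
Proof.
have dh a : defect (halve a) = halve (defect a) by rewrite halve_linear.
have dD a b : defect (a + b) = defect a + defect b by apply: linearD.
have dN a : defect (- a) = - defect a by apply: linearN.
by rewrite /newton_factor dD dN !dh dD.
Qed.

Lemma iter_newton_defect (d' : P -> P) :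
  (forall x, d' x = newton_step (newton_step x) - x) ->
  forall j x, iter j d' x = iter j newton_factor (iter j.*2 defect x).
Proof.
have comm j v : defect (iter j newton_factor v) = iter j newton_factor (defect v).
  by elim: j => // j IH; rewrite !iterS defect_newton_factor IH.
move=> d'E; elim=> // j IH x.
by rewrite iterS IH d'E newton_defect !comm doubleS !iterS.
Qed.

End Newton.

(** A semilinear lift of T has a nilpotent defect, since the defect has values in the
    superfluous kernel of u; a Newton step lowers the order of nilpotency and preserves
    the property of lifting T, as u annihilates the defect. *)
Lemma lift_involution : exists2 S : P -> P, semilinear_involution s S &
  forall x, u (S x) = T (u x).
Proof.
have [S0 SL0 uS0] := semilinear_lift; have [TD TZ TT] := TI.
have udef S (SL : semilinear s S) : (forall x, u (S x) = T (u x)) ->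
    forall x, u (defect SL x) = 0.
  by move=> uS x; rewrite mk_linearE raddfB /= !uS TT subrr.
have [|N] := superfluous_nilpotent fdA fgP supu (udef S0 SL0 uS0).
  by move=> c x ux; rewrite linear_scalars ux scaler0.
elim: N S0 SL0 uS0 => [|[|N] IH] S SL uS /= nil.
- by exists S => //; case: (SL) => SD SZ; split=> // x; rewrite [LHS]nil [RHS]nil.
- exists S => //; case: (SL) => SD SZ; split=> // x.
  by apply/eqP; rewrite -subr_eq0; apply/eqP/nil.
apply: (IH _ (newton_step_semilinear SL)) => [x|x].
  rewrite uS raddfB /= -halve_linear udef // halve0 subr0.
  by [].
change (iter N.+1 (defect (newton_step_semilinear SL)) x = 0).
rewrite (@iter_newton_defect S SL) //.
have zero v : iter N.+2 (defect SL) v = 0 by apply: nil.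
(* The (N + 1)-st power of the new defect is a multiple of the power 2 (N + 1) of the
   old one, whose power N + 2 vanishes. *)
have -> : (N.+1.*2 = N + N.+2)%N by rewrite doubleS -addnn !addnS.
rewrite iterD zero.
have d0 : defect SL 0 = 0 by apply: linear0.
have dN0 n : iter n (defect SL) 0 = 0 by elim: n => // n E; rewrite iterS E.
have r0 : newton_factor SL 0 = 0.
  by rewrite /newton_factor d0 oppr0 addr0 !halve0 addr0.
by rewrite dN0; elim: N.+1 => // n E; rewrite iterS E.
Qed.

End LiftInvolution.

(** * Extending minimal presentations to the skew group algebra *)

Section ExtendRigid.
Variables (k : closedFieldType) (A : algType k) (gT : finGroupType) (sigma : gT).
Hypotheses (two_neq0 : (2%:R : k) != 0) (fdA : finite_span A).
Hypotheses (sigma_neq1 : sigma != 1%g) (G_eq : [set: gT]%SET = [set 1%g; sigma]%SET).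
Variable act : alg_action gT A.
Local Notation B := (skew_algebra act).
Local Notation s := (act sigma).
Local Notation inc := (skew_incl act).
Local Notation w := (skew_tensor act 1 sigma : B).
Local Notation swapI Y := (@skew_swapI _ _ _ _ sigma_neq1 G_eq act Y).
Local Notation act_invol := (act_invol sigma_neq1 G_eq act).
Local Notation swap := (@skew_swap _ _ _ sigma act _).

Section Extension.
Variables (P : lmodType A^c) (S : P -> P) (SI : semilinear_involution s S).
Local Notation PS := (skew_ext_of sigma_neq1 G_eq SI).

Lemma from_skew_ext_linear (Y : lmodType B^c) (f : {linear P -> skew_res Y}) :
  (forall x, f (S x) = swap (f x)) -> linear (f : PS -> Y).
Proof.
move=> fS b x y.
have -> : (b *: x + y : PS) = ((b : B) 1%g : A^c) *: (x : P)
    + S (((b : B) sigma : A^c) *: (x : P)) + (y : P) :> P by [].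
have fD u v : f (u + v) = f u + f v by apply: linearD.
have fZ (a : A) u : f ((a : A^c) *: u) = (a : A^c) *: f u by apply: linearZ.
rewrite !fD fS !fZ; congr (_ + _).
exact/esym/(skew_scaleE sigma_neq1 G_eq b (f x)).
Qed.

Lemma to_skew_res_linear (Y : lmodType B^c) (f : {linear PS -> Y}) :
  linear (f : P -> skew_res Y).
Proof.
move=> a x y.
have -> : (a : A^c) *: x + y = ((inc a : B^c) *: (x : PS) + (y : PS) : PS) :> P.
  by rewrite -(skew_ext_inc (sigma_neq1 := sigma_neq1) (G_eq := G_eq) (SI := SI)).
exact: linearP.
Qed.

Lemma skew_ext_fg : finitely_generated P -> finitely_generated PS.
Proof.
move=> [n [g gP]]; exists n, g => x; have [c ->] := gP x.
exists (fun i => inc (c i)); apply: eq_bigr => i _.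
by rewrite -(skew_ext_inc (sigma_neq1 := sigma_neq1) (G_eq := G_eq) (SI := SI)).
Qed.

Lemma skew_ext_comm (Y : lmodType B^c) (f : {linear PS -> Y}) x :
  f (S x) = swap (f x).
Proof.
by rewrite -(skew_ext_swap (sigma_neq1 := sigma_neq1) (G_eq := G_eq) (SI := SI)) linearZ.
Qed.

(** An A-linear lift of a B-linear map remains a lift when it is replaced by its even
    part. *)
Lemma skew_ext_projective : projective P -> projective PS.
Proof.
move=> prP X Y q h q_surj.
have [l lE] := prP (skew_res X) (skew_res Y) (mk_linear (skew_res_linear q))
  (mk_linear (to_skew_res_linear h)) q_surj.
have eS x : even_part SI (swapI X) act_invol l (S x) =
    swap (even_part SI (swapI X) act_invol l x) by apply: even_part_comm.
exists (mk_linear (from_skew_ext_linear eS)) => x.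
pose qA : {linear skew_res X -> skew_res Y} := mk_linear (skew_res_linear q).
change (qA (halve (l x + swap (l (S x)))) = h x).
have qswap y : qA (swap y) = swap (qA y) by apply: linearZ.
have qD y z : qA (y + z) = qA y + qA z by apply: raddfD.
rewrite -halve_linear qD qswap !lE.
have -> : mk_linear (to_skew_res_linear h) (S x) = swap (h x) by apply: skew_ext_comm.
have [_ _ ->] := swapI Y.
exact: halve_double.
Qed.

Lemma skew_ext_superfluous (K : P -> Prop) :
  superfluous K -> superfluous (K : PS -> Prop).
Proof.
move=> supK L Lsub; apply: (supK (L : {pred P})).
have [L0 LP] := Lsub; split=> // a x y Lx Ly.
have -> : (a : A^c) *: x + y = ((inc a : B^c) *: (x : PS) + (y : PS) : PS) :> P.
  by rewrite -(skew_ext_inc (sigma_neq1 := sigma_neq1) (G_eq := G_eq) (SI := SI)).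
exact: LP.
Qed.

End Extension.

(** P0 and P1 become B-modules by lifting the involution of Y first to P0 and then, along
    f, to P1.  A factorisation over A of a B-linear map is averaged to a B-linear one. *)
Lemma tau_rigid_extend (Y : lmodType B^c) : tau_rigid (skew_res Y) -> tau_rigid Y.
Proof.
move=> /tau_rigidP [P1 [P0 [f [p [mp fac]]]]].
have [[fg1 fg0] [pr1 pr0] [p_surj ex] sup0 sup1] := mp.
have [S0 SI0 pS0] : exists2 S : P0 -> P0, semilinear_involution s S &
    forall x, p (S x) = swap (p x).
  by apply: (lift_involution two_neq0 fdA act_invol fg0 pr0 sup0 (swapI Y)).
have [S1 SI1 fS1] : exists2 S : P1 -> P1, semilinear_involution s S &
    forall x, f (S x) = S0 (f x).
  apply: (lift_involution two_neq0 fdA act_invol fg1 pr1 sup1 SI0) => x.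
  apply/ex; rewrite pS0; have -> : p (f x) = 0 by apply/ex; exists x.
  exact: (semilinear0 (involution_semilinear (swapI Y))).
pose Q1 : lmodType B^c := skew_ext_of sigma_neq1 G_eq SI1.
pose Q0 : lmodType B^c := skew_ext_of sigma_neq1 G_eq SI0.
have f_linear : linear (f : Q1 -> Q0).
  move=> b x y.
  have -> : (b *: x + y : Q1) = ((b : B) 1%g : A^c) *: (x : P1)
      + S1 (((b : B) sigma : A^c) *: (x : P1)) + (y : P1) :> P1 by [].
  have fD u v : f (u + v) = f u + f v by apply: linearD.
  have fZ (a : A) u : f ((a : A^c) *: u) = (a : A^c) *: f u by apply: linearZ.
  by rewrite !fD fS1 !fZ.
apply/tau_rigidP; exists Q1, Q0, (mk_linear f_linear).
exists (mk_linear (from_skew_ext_linear (SI := SI0) pS0)); split.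
  split.
  - by split; apply: skew_ext_fg.
  - by split; apply: skew_ext_projective.
  - by [].
  - exact: (skew_ext_superfluous (SI := SI0) sup0).
  - exact: (skew_ext_superfluous (SI := SI1) sup1).
move=> g.
have [h hE] := fac (mk_linear (to_skew_res_linear (SI := SI1) g)).
have eS x : even_part SI0 (swapI Y) act_invol h (S0 x) =
    swap (even_part SI0 (swapI Y) act_invol h x) by apply: even_part_comm.
exists (mk_linear (from_skew_ext_linear (SI := SI0) eS)) => y.
change (g y = halve (h (f y) + swap (h (S0 (f y))))).
rewrite -fS1 -!hE.
have -> : mk_linear (to_skew_res_linear (SI := SI1) g) (S1 y) = swap (g y).
  exact: (skew_ext_comm (SI := SI1)).
have [_ _ ->] := swapI Y.
exact: esym (halve_double (P := skew_res Y) two_neq0 (g y)).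
Qed.

End ExtendRigid.

(** * Induced modules *)

Section Induced.
Variables (k : closedFieldType) (A : algType k) (gT : finGroupType) (sigma : gT).
Hypotheses (two_neq0 : (2%:R : k) != 0) (fdA : finite_span A).
Hypotheses (sigma_neq1 : sigma != 1%g) (G_eq : [set: gT]%SET = [set 1%g; sigma]%SET).
Variable act : alg_action gT A.
Local Notation B := (skew_algebra act).
Local Notation s := (act sigma).
Local Notation inc := (skew_incl act).
Local Notation w := (skew_tensor act 1 sigma : B).
Local Notation swap := (@skew_swap _ _ _ sigma act _).
Variables (M : lmodType A^c) (FM : lmodType B^c) (t : M -> B -> FM).
Hypothesis tFM : is_tensor_product inc t.
Local Notation X := (M * twist s M)%type.

Lemma inc_mulE a (x : B) g : (inc a * x) g = a * x g.
Proof.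
have [->|->] := order2P G_eq g.
  by rewrite (skew_mul1 sigma_neq1 G_eq) !ffunE eqxx (negbTE sigma_neq1) mul0r addr0.
by rewrite (skew_mulsigma sigma_neq1 G_eq) !ffunE eqxx (negbTE sigma_neq1) mul0r addr0.
Qed.

(** The identification of M (+) sigma M with the restriction of FM. *)
Definition to_induced (x : X) : skew_res FM := t x.1 1 + t x.2 w.

Lemma to_induced_linear : linear to_induced.
Proof.
have [[tDl tDr tA] tB _] := tFM => a x y; rewrite /to_induced /=.
rewrite !tDl tA mulr1.
have -> : t (a *: x.2) w = t x.2 (w * inc a) by rewrite w_inc -tA.
rewrite -[inc a in LHS]mul1r !tB addrACA; congr (_ + _).
by rewrite mul1r -(@scalerDr B^c FM).
Qed.

Lemma from_induced_exists : exists h : {additive FM -> X},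
  forall m x, h (t m x) = ((x 1%g : A^c) *: m, ((x sigma : A^c) *: m : twist s M)).
Proof.
have [_ _ univ] := tFM.
have [|h hE _] := univ X (fun m x => ((x 1%g : A^c) *: m, ((x sigma : A^c) *: m : twist s M)));
  last by exists h.
split=> [m m' x|m x x'|m a x].
- by rewrite !scalerDr.
- by rewrite !ffunE !(@scalerDl A^c M).
- by rewrite !inc_mulE !ract_mul.
Qed.

(** The inverse comes from the universal property, whose uniqueness part shows that it is
    one: the composite FM -> M (+) sigma M -> FM and the identity agree on the tensors. *)
Lemma induced_iso : exists2 h : skew_res FM -> X, cancel to_induced h & cancel h to_induced.
Proof.
have [[tDl tDr tA] tB univ] := tFM; have [h hE] := from_induced_exists.
exists h.
  move=> [m m']; rewrite /to_induced raddfD !hE /= !ffunE !eqxx (negbTE sigma_neq1).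
  rewrite [_ == sigma]eq_sym (negbTE sigma_neq1).
  rewrite !(@scale0r A^c M) !(@scale1r A^c M).
  by congr pair; [apply: addr0|apply: (@add0r M m')].
have [h0 _ h0U] := univ FM t (And3 tDl tDr tA).
pose th : {additive FM -> FM} := (mk_linear to_induced_linear : {additive X -> FM}) \o h.
have thE m x : th (t m x) = t m x.
  rewrite /th /= hE /to_induced /= !tA mulr1 -tDr.
  by rewrite -(skew_decomp sigma_neq1 G_eq x).
by move=> y; rewrite -[LHS]/(th y) (h0U th thE) -(h0U idfun (fun m x => erefl)).
Qed.

Lemma swap_to_induced m m' : swap (to_induced (m, m')) = to_induced (m', m).
Proof.
have [[tDl tDr tA] tB univ] := tFM.
rewrite /skew_swap /to_induced /= (@scalerDr B^c FM) -!tB mul1r.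
by rewrite (ww sigma_neq1 G_eq) addrC.
Qed.

(** The swap exchanges the two summands, hence anticommutes with the sign change eps of the
    second one. *)
Lemma tau_rigid_induced : tau_rigid X <-> tau_rigid FM.
Proof.
have [h toK fromK] := induced_iso.
pose u : {linear X -> skew_res FM} := mk_linear to_induced_linear.
have h_linear : linear h by apply: (can2_linear (f := u)).
pose v : {linear skew_res FM -> X} := mk_linear h_linear.
split=> [rX|rFM].
  apply: (tau_rigid_extend two_neq0 fdA sigma_neq1 G_eq).
  exact: (tau_rigid_iso (u := u) (v := v) toK fromK rX).
have sign_linear : linear (fun x : X => (x.1, - x.2) : X).
  by move=> a [x x'] [y y']; congr pair; rewrite /= opprD -scalerN.
pose eps : {linear skew_res FM -> skew_res FM} := (u \o mk_linear sign_linear \o v).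
have epsE x : eps (u x) = u (x.1, - x.2).
  by rewrite /eps /= toK.
have swapE x : swap (u x) = u (x.2, x.1) by case: x => m m'; apply: swap_to_induced.
have uN z : - u z = u (- z) by rewrite linearN.
have uE y : y = u (h y) by rewrite -[LHS]fromK.
have rR : tau_rigid (skew_res FM).
  apply: (tau_rigid_restrict two_neq0 sigma_neq1 G_eq (eps := eps)) rFM => y.
    by rewrite (uE y) !epsE /= opprK -surjective_pairing.
  rewrite (uE y) swapE !epsE swapE uN; apply: (congr1 (u : X -> skew_res FM)).
  by congr pair; rewrite /= opprK.
exact: (tau_rigid_iso (u := v) (v := u) fromK toK rR).
Qed.

End Induced.

Theorem proposition6p8
  (k : closedFieldType) (char_k : 2%N \notin [pchar k])
  (Q : quiver) (dimer_Q : dimer_tree_quiver Q)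
  (C0 : {set arrow Q}) (root_C0 : root_cycle C0)
  (A : algType k) (pi : {rmorphism path_algebra k Q -> A})
  (jac_A : is_jacobian_algebra (potential k C0) pi)
  (gT : finGroupType) (sigma : gT)
  (sigma_neq1 : sigma != 1%g) (G_eq : [set: gT] = [set 1%g; sigma])
  (act : alg_action gT A) (adm : admissible pi (act sigma))
  (M : lmodType A^c) (fg_M : finitely_generated M)
  (FM : lmodType (skew_algebra act)^c) (t : M -> skew_algebra act -> FM)
  (tensor_FM : is_tensor_product (skew_incl act) t) :
  tau_rigid (M * twist (act sigma) M)%type <-> tau_rigid FM.
Proof.
have two_neq0 : (2%:R : k) != 0.
  by apply: contraNneq char_k => two0; rewrite inE /= two0.
exact: (tau_rigid_induced two_neq0 (jacobian_finite_span dimer_Q jac_A)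
          sigma_neq1 G_eq tensor_FM).
Qed.
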